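(* Let $\mathbb{F}$ be a field with $\operatorname{char}\mathbb{F}\neq 2,3$, and let $A$ and $B$ be unital locally matrix $\mathbb{F}$-algebras. For an arbitrary isomorphism of multiplicative groups $\varphi:A^{*}\to B^{*}$ there exist a central homothety $\chi:A^{*}/[A^{*},A^{*}]\to\mathbb{F}^{*}$ and either an isomorphism of rings $\theta_1:A\to B$ such that $$\varphi(g)=\chi(g)\,\theta_1(g)\quad\text{for all } g\in A^{*},$$ or an anti-isomorphism of rings $\theta_2:A\to B$ such that $$\varphi(g)=\chi(g)\,\theta_2(g^{-1})\quad\text{for all } g\in A^{*}.$$
   Context: An associative $\mathbb{F}$-algebra $A$ with unit $1$ is a unital locally matrix algebra if for every finite collection $a_1,\ldots,a_t\in A$ there is a subalgebra $A'\subset A$ with $1,a_1,\ldots,a_t\in A'$ and $A'\cong M_n(\mathbb{F})$ for some $n\in\mathbb{N}$ (positive integers). $A^{*}$ denotes the group of invertible elements of $A$, and $[A^{*},A^{*}]$ its commutator subgroup. A central homothety of $A^{*}$ is a multiplicative group homomorphism $\chi:A^{*}/[A^{*},A^{*}]\to\mathbb{F}^{*}$; for $g\in A^{*}$, $\chi(g)$ denotes the value of $\chi$ on the coset of $g$. A map $\varphi:R\to S$ of rings is an anti-isomorphism if it is an isomorphism of additive groups and $\varphi(ab)=\varphi(b)\varphi(a)$ for all $a,b\in R$. Ring isomorphisms and anti-isomorphisms are not required to be $\mathbb{F}$-linear. ''Either ... or'' is understood non-exclusively. *)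

(* Defs.v *)
From HB Require Import structures.
From mathcomp Require Import all_boot all_order all_algebra.
From mathcomp Require Import boolp.

Set Implicit Arguments.
Unset Strict Implicit.
Unset Printing Implicit Defensive.

Import GRing.Theory.

Local Open Scope ring_scope.

(* An infinite-ring counterpart of [{unit R}], which needs [R] to be finite. *)
Section UnitGroup.
Variable R : unitRingType.

Record units := Units { units_val :> R; _ : units_val \is a GRing.unit }.

HB.instance Definition _ := [isSub for units_val].
HB.instance Definition _ := [Choice of units by <:].

Implicit Types g h : units.

Lemma unitsP g : val g \is a GRing.unit. Proof. exact: valP. Qed.

Definition units_one : units := Units (unitr1 R).
Definition units_inv g : units :=
  @Units (val g)^-1 (etrans (unitrV (val g)) (unitsP g)).

Fact units_mul_subproof g h : val g * val h \is a GRing.unit.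
Proof. by rewrite unitrMl unitsP. Qed.

Definition units_mul g h : units := Units (units_mul_subproof g h).

Fact units_mulA : associative units_mul.
Proof. by move=> x y z; apply/val_inj; exact: mulrA. Qed.
Fact units_mul1 : left_id units_one units_mul.
Proof. by move=> x; apply/val_inj; exact: mul1r. Qed.
Fact units_mulr1 : right_id units_one units_mul.
Proof. by move=> x; apply/val_inj; exact: mulr1. Qed.
Fact units_mulV : left_inverse units_one units_inv units_mul.
Proof. by move=> x; apply/val_inj; exact: mulVr (unitsP x). Qed.
Fact units_mulrV : right_inverse units_one units_inv units_mul.
Proof. by move=> x; apply/val_inj; exact: mulrV (unitsP x). Qed.

HB.instance Definition _ :=
  isGroup.Build units units_mulA units_mul1 units_mulr1 units_mulV units_mulrV.

Lemma val_units1 : val (1%g : units) = 1. Proof. by []. Qed.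
Lemma val_unitsM g h : val (g * h)%g = val g * val h. Proof. by []. Qed.
Lemma val_unitsV g : val (g^-1)%g = (val g)^-1. Proof. by []. Qed.

End UnitGroup.

Section Abelianization.
Variable G : groupType.
Local Open Scope group_scope.

Inductive derived : G -> Prop :=
| derivedR x y : derived [~ x, y]
| derived1 : derived 1
| derivedM x y : derived x -> derived y -> derived (x * y)
| derivedV x : derived x -> derived x^-1.

Lemma derivedJ x y : derived x -> derived (x ^ y).
Proof.
have -> : x ^ y = x * [~ x, y] by rewrite /commg mulgA mulgV mul1g.
by move=> dx; apply: derivedM => //; exact: derivedR.
Qed.

Definition eq_mod_derived : rel G := fun x y => `[< derived (x^-1 * y) >].

Fact eq_mod_derived_refl : reflexive eq_mod_derived.
Proof. by move=> x; apply/asboolP; rewrite mulVg; exact: derived1. Qed.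

Fact eq_mod_derived_sym : symmetric eq_mod_derived.
Proof.
have sub x y : derived (x^-1 * y) -> derived (y^-1 * x).
  by move=> /derivedV; rewrite invgM invgK.
by move=> x y; apply/asboolP/asboolP; exact: sub.
Qed.

Fact eq_mod_derived_trans : transitive eq_mod_derived.
Proof.
move=> y x z /asboolP dxy /asboolP dyz; apply/asboolP.
by have := derivedM dxy dyz; rewrite mulgA -(mulgA _ y) mulgV mulg1.
Qed.

Canonical eq_mod_derived_equiv :=
  EquivRel eq_mod_derived eq_mod_derived_refl eq_mod_derived_sym
    eq_mod_derived_trans.

Definition abelianization := {eq_quot eq_mod_derived}%qT.

HB.instance Definition _ := Choice.on abelianization.

Definition abel (x : G) : abelianization := (\pi_({eq_quot eq_mod_derived}) x)%qT.
Definition abel_repr (u : abelianization) : G :=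
  repr (u : {eq_quot eq_mod_derived}%qT).

Lemma abel_reprK : cancel abel_repr abel.
Proof. by move=> u; rewrite /abel /abel_repr reprK. Qed.

Lemma abelP x y : abel x = abel y <-> derived (x^-1 * y).
Proof. by split=> [/eqmodP/asboolP | d]; last exact/eqmodP/asboolP. Qed.

Definition abel_mul (u v : abelianization) := abel (abel_repr u * abel_repr v).
Definition abel_inv (u : abelianization) := abel (abel_repr u)^-1.

Lemma abel_mulE x y : abel_mul (abel x) (abel y) = abel (x * y).
Proof.
have /abelP := abel_reprK (abel x); have /abelP := abel_reprK (abel y).
rewrite /abel_mul; set x' := abel_repr _; set y' := abel_repr _ => dy dx.
apply/abelP; have := derivedM dy (derivedJ y dx).
by rewrite /conjg invgM !mulgA -(mulgA _ y y^-1) mulgV mulg1.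
Qed.

Lemma abel_invE x : abel_inv (abel x) = abel x^-1.
Proof.
have /abelP := abel_reprK (abel x).
rewrite /abel_inv; set x' := abel_repr _ => dx.
apply/abelP; have := derivedV (derivedJ x^-1 dx).
by rewrite /conjg invgK !mulgA -(mulgA _ x x^-1) mulgV mulg1 invgM invgK.
Qed.

Fact abel_mulA : associative abel_mul.
Proof.
move=> u v w; rewrite -[u]abel_reprK -[v]abel_reprK -[w]abel_reprK.
by rewrite !abel_mulE mulgA.
Qed.
Fact abel_mul1 : left_id (abel 1) abel_mul.
Proof. by move=> u; rewrite -[u]abel_reprK abel_mulE mul1g. Qed.
Fact abel_mulg1 : right_id (abel 1) abel_mul.
Proof. by move=> u; rewrite -[u]abel_reprK abel_mulE mulg1. Qed.
Fact abel_mulV : left_inverse (abel 1) abel_inv abel_mul.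
Proof. by move=> u; rewrite -[u]abel_reprK abel_invE abel_mulE mulVg. Qed.
Fact abel_mulgV : right_inverse (abel 1) abel_inv abel_mul.
Proof. by move=> u; rewrite -[u]abel_reprK abel_invE abel_mulE mulgV. Qed.

HB.instance Definition _ :=
  isGroup.Build abelianization abel_mulA abel_mul1 abel_mulg1 abel_mulV
    abel_mulgV.

Fact abel_is_mul : {morph abel : x y / x * y}.
Proof. by move=> x y; rewrite -abel_mulE. Qed.

HB.instance Definition _ := isGroupMorphism.Build G abelianization abel
  (fun x y => etrans (abel_is_mul x y^-1) (congr1 _ (esym (abel_invE y)))).

End Abelianization.

(* A [subAlgType S] carries the algebra structure induced on [S], including
   the unit of [A]; matrices have positive size [n.+1]. *)
Definition unital_locally_matrix (F : fieldType) (A : algType F) : Prop :=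
  forall s : seq A,
  exists (S : {pred A}) (A' : subAlgType S),
    [/\ 1 \in S, {subset s <= S}
      & exists (n : nat) (f : {lrmorphism A' -> 'M[F]_n.+1}), bijective f].

Definition central_homothety (F : fieldType) (A : unitAlgType F) : Type :=
  {multiplicative abelianization (units A) -> units F}.

Definition anti_isomorphism (R S : pzRingType) (f : {additive R -> S}) : Prop :=
  bijective f /\ forall a b, f (a * b) = f b * f a.

(* Main.v *)
Require Import Defs.
From HB Require Import structures.
From mathcomp Require Import all_boot all_order all_algebra.
From mathcomp Require Import boolp ring.

(** The isomorphism is recovered from the conjugation action on root subgroups.
  Fix an idempotent [e != 0, 1] of [A], with complement [f].  As [char F <> 2],
  idempotents correspond to involutions, so [phi (1 - 2 e) = 1 - 2 e'].  The
  subgroup [1 + e A f] is commutative, uniquely 2-divisible, inverted by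
  [1 - 2 e] and normalised by the centraliser of [1 - 2 e]; since 2 is a unit of
  [F] with [2^2 != 1], these properties force its image into [1 + e' B f'] or
  [1 + f' B e'].  Exchanging [e'] and [f'] if necessary, [phi (1 + x) = 1 + al x]
  on [e A f] and [phi (1 + y) = 1 + be y] on [f A e] with additive bijections.
  The LDU factorisation of [(1 + x)(1 + y)] shows that [(al, be)] respects
  quasi-inverses, and rank-one elements then give [al (x y x) = al x be y al x].
  By a Herstein-type argument in the prime ring [B], either
  [al (x y z) = al x be y al z] always or [al (x y z) = al z be y al x] always.
  In the first case [(al, be)] extends to a ring isomorphism, because
  [A = e A f + f A e + e A f A e + f A e A f]; the second case is the first one
  for the opposite ring of [B] and [g |-> (phi g)^-1].  Finally [A^*] is
  generated by the two root subgroups and the centraliser of [e] (unit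
  regularity), on which [phi] and the isomorphism differ by central factors. *)

Set Implicit Arguments.
Unset Strict Implicit.
Unset Printing Implicit Defensive.

Import GRing.Theory.

Local Open Scope ring_scope.

(** * Identities in noncommutative rings *)

(* [check n rs t u] decides [t = u] by expanding [t - u] into words and applying
   [n] rounds of the relations in [rs], oriented from a word (the left-hand
   side) to a polynomial. *)
Module NCRing.

Inductive expr :=
  | Zero | One | Var of nat | Add of expr & expr | Opp of expr
  | Mul of expr & expr | Muln of expr & nat.

Definition word := seq nat.
Definition poly := seq (int * word).

Definition pmul (p q : poly) : poly :=
  [seq (m.1 * m'.1, m.2 ++ m'.2) | m <- p, m' <- q].
Definition pscale (c : int) (p : poly) : poly := [seq (c * m.1, m.2) | m <- p].

Fixpoint expand (t : expr) : poly :=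
  match t with
  | Zero => [::]
  | One => [:: (1, [::])]
  | Var i => [:: (1, [:: i])]
  | Add t u => expand t ++ expand u
  | Opp t => pscale (-1) (expand t)
  | Mul t u => pmul (expand t) (expand u)
  | Muln t n => pscale n%:Z (expand t)
  end.

Fixpoint find_rule (rs : seq (word * poly)) (w : word) : option (poly * word) :=
  if rs is (l, p) :: rs' then
    if prefix l w then Some (p, drop (size l) w) else find_rule rs' w
  else None.

(** A round replaces only the leftmost match; the rest of the word waits for the next round, which
    keeps the recursion structural whatever the rules are. *)
Fixpoint rewrite_word (rs : seq (word * poly)) (w : word) : poly :=
  if find_rule rs w is Some (p, w') then pmul p [:: (1, w')]
  else if w is i :: w' then pmul [:: (1, [:: i])] (rewrite_word rs w')
  else [:: (1, [::])].

Definition rewrite_poly rs (p : poly) : poly :=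
  flatten [seq pscale m.1 (rewrite_word rs m.2) | m <- p].

Fixpoint collect (n : nat) (p : poly) : poly :=
  match n, p with
  | n'.+1, m :: p' =>
    let c := foldr (fun m' c => m'.1 + c) 0 [seq m' <- p | m'.2 == m.2] in
    let q := collect n' [seq m' <- p | m'.2 != m.2] in
    if c == 0 then q else (c, m.2) :: q
  | _, _ => p
  end.

(** A relation whose left-hand side is not a single word with coefficient 1 is dropped: this costs
    completeness, never soundness. *)
Definition rule_of (lr : expr * expr) : seq (word * poly) :=
  if expand lr.1 is [:: (1, w)] then [:: (w, expand lr.2)] else [::].

Definition step rs p := let q := rewrite_poly rs p in collect (size q) q.

Definition check (n : nat) (rs : seq (expr * expr)) (t u : expr) : bool :=
  iter n (step (flatten (map rule_of rs))) (expand (Add t (Opp u))) == [::].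

Section Correct.
Variables (R : pzRingType) (env : seq R).

Fixpoint eval (t : expr) : R :=
  match t with
  | Zero => 0
  | One => 1
  | Var i => nth 0 env i
  | Add t u => eval t + eval u
  | Opp t => - eval t
  | Mul t u => eval t * eval u
  | Muln t n => eval t *+ n
  end.

Definition evalw (w : word) : R := \prod_(i <- w) nth 0 env i.
Definition evalp (p : poly) : R := \sum_(m <- p) evalw m.2 *~ m.1.

Fixpoint holds (rs : seq (expr * expr)) : Prop :=
  if rs is (l, r) :: rs' then eval l = eval r /\ holds rs' else True.

Lemma evalp_cat p q : evalp (p ++ q) = evalp p + evalp q.
Proof. exact: big_cat. Qed.

Lemma evalp_cons m p : evalp (m :: p) = evalw m.2 *~ m.1 + evalp p.
Proof. exact: big_cons. Qed.

Lemma evalw_cat v w : evalw (v ++ w) = evalw v * evalw w.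
Proof. exact: big_cat. Qed.

Lemma evalp_scale c p : evalp (pscale c p) = evalp p *~ c.
Proof.
rewrite /evalp /pscale big_map; elim: p => [|m p IH]; first by rewrite !big_nil mul0rz.
by rewrite !big_cons IH mulrzDl mulrC -mulrzA.
Qed.

Lemma evalp_mul p q : evalp (pmul p q) = evalp p * evalp q.
Proof.
rewrite /pmul /evalp; elim: p => [|m p IH]; first by rewrite !big_nil mul0r.
rewrite allpairs_cons big_cat big_cons mulrDl -IH; congr (_ + _).
rewrite big_map mulr_sumr; apply: eq_bigr => m' _ /=.
by rewrite evalw_cat mulrzA -mulrzAl -mulrzAr.
Qed.

Lemma evalp1 w : evalp [:: (1, w)] = evalw w.
Proof. by rewrite /evalp big_seq1. Qed.

Lemma expandP t : evalp (expand t) = eval t.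
Proof.
elim: t => [||i|t IHt u IHu|t IHt|t IHt u IHu|t IHt n] /=.
- exact: big_nil.
- by rewrite evalp1 /evalw big_nil.
- by rewrite evalp1 /evalw big_seq1.
- by rewrite evalp_cat IHt IHu.
- by rewrite evalp_scale IHt mulrN1z.
- by rewrite evalp_mul IHt IHu.
- by rewrite evalp_scale IHt pmulrn.
Qed.

Definition valid_rules (rs : seq (word * poly)) :=
  forall l p, (l, p) \in rs -> evalw l = evalp p.

Lemma find_ruleP rs w p v : valid_rules rs -> find_rule rs w = Some (p, v) ->
  evalw w = evalp p * evalw v.
Proof.
elim: rs => // -[l q] rs IH valid_rs /=; case: prefixP => [[s ->]|_].
  case=> <- <-; rewrite drop_size_cat // evalw_cat.
  by rewrite (valid_rs l q) ?mem_head.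
by apply: IH => l' p' rs_lp; apply: valid_rs; rewrite in_cons rs_lp orbT.
Qed.

Lemma rewrite_wordP rs w : valid_rules rs -> evalp (rewrite_word rs w) = evalw w.
Proof.
move=> valid_rs; elim: w => [|i w IH] /=.
  case E: (find_rule rs [::]) => [[p v]|]; last exact: evalp1.
  by rewrite evalp_mul evalp1 (find_ruleP valid_rs E).
case E: (find_rule rs _) => [[p v]|].
  by rewrite evalp_mul evalp1 (find_ruleP valid_rs E).
by rewrite evalp_mul evalp1 IH -evalw_cat.
Qed.

Lemma rewrite_polyP rs p : valid_rules rs -> evalp (rewrite_poly rs p) = evalp p.
Proof.
move=> valid_rs; elim: p => // m p IH.
by rewrite evalp_cat IH evalp_scale rewrite_wordP // evalp_cons.
Qed.

Lemma collectP n p : evalp (collect n p) = evalp p.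
Proof.
elim: n p => // n IH [|m p] //.
have split q : evalp q =
    evalw m.2 *~ foldr (fun m' c => m'.1 + c) 0 [seq m' <- q | m'.2 == m.2]
    + evalp [seq m' <- q | m'.2 != m.2].
  elim: q => [|a q IHq] /=; first by rewrite mulr0z add0r.
  rewrite evalp_cons IHq; case: eqP => [->|_] /=.
    by rewrite mulrzDr addrA.
  by rewrite evalp_cons addrCA.
rewrite [RHS]split /=; case: eqP => [->|_]; rewrite ?evalp_cons IH ?eqxx //=.
by rewrite mulr0z add0r.
Qed.

Lemma rule_ofP rs : holds rs -> valid_rules (flatten (map rule_of rs)).
Proof.
elim: rs => // -[l r] rs IH [lr holds_rs] l' p'.
rewrite /= mem_cat => /orP[|]; last exact: IH.
rewrite /rule_of /=; case E: (expand l) => [|[c w] [|? ?]] //.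
  case: c E => // -[|[|c]] // E; rewrite inE => /eqP[-> ->].
  by rewrite expandP -lr -expandP E evalp1.
by case: c {E} => // -[|[|c]].
Qed.

Lemma checkP n rs t u : holds rs -> check n rs t u -> eval t = eval u.
Proof.
move=> /rule_ofP valid_rs /eqP chk; apply: subr0_eq.
rewrite -[LHS]/(eval (Add t (Opp u))) -expandP.
have -> : evalp (expand (Add t (Opp u))) =
    evalp (iter n (step (flatten (map rule_of rs))) (expand (Add t (Opp u)))).
  by elim: n {chk} => //= n ->; rewrite /step collectP rewrite_polyP.
by rewrite chk /evalp big_nil.
Qed.

End Correct.
End NCRing.

(** * Reification of ring equations *)

Ltac nc_mem x l :=
  lazymatch l with
  | [::] => constr:(false)
  | x :: _ => constr:(true)
  | _ :: ?l' => nc_mem x l'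
  end.

Ltac nc_index x l :=
  lazymatch l with
  | x :: _ => constr:(O)
  | _ :: ?l' => let n := nc_index x l' in constr:(S n)
  end.

Ltac nc_atoms t l :=
  lazymatch t with
  | @GRing.zero _ => l
  | @GRing.one _ => l
  | @GRing.add _ ?a ?b => let l := nc_atoms a l in nc_atoms b l
  | @GRing.opp _ ?a => nc_atoms a l
  | @GRing.mul _ ?a ?b => let l := nc_atoms a l in nc_atoms b l
  | @GRing.natmul _ ?a _ => nc_atoms a l
  | _ => lazymatch nc_mem t l with true => l | false => constr:(t :: l) end
  end.

Ltac nc_reify t l :=
  lazymatch t with
  | @GRing.zero _ => constr:(NCRing.Zero)
  | @GRing.one _ => constr:(NCRing.One)
  | @GRing.add _ ?a ?b =>
    let u := nc_reify a l in let v := nc_reify b l in constr:(NCRing.Add u v)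
  | @GRing.opp _ ?a => let u := nc_reify a l in constr:(NCRing.Opp u)
  | @GRing.mul _ ?a ?b =>
    let u := nc_reify a l in let v := nc_reify b l in constr:(NCRing.Mul u v)
  | @GRing.natmul _ ?a ?n => let u := nc_reify a l in constr:(NCRing.Muln u n)
  | _ => let n := nc_index t l in constr:(NCRing.Var n)
  end.

Ltac nc_hyps_atoms hs l :=
  lazymatch hs with
  | tt => l
  | (?hs', ?h) => let l := nc_hyps_atoms hs' l in nc_hyps_atoms h l
  | _ => lazymatch type of hs with
         | @eq _ ?a ?b => let l := nc_atoms a l in nc_atoms b l end
  end.

Ltac nc_hyps_rules hs l acc :=
  lazymatch hs with
  | tt => acc
  | (?hs', ?h) =>
    let acc := nc_hyps_rules h l acc in nc_hyps_rules hs' l acc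
  | _ => lazymatch type of hs with
         | @eq _ ?a ?b =>
           let u := nc_reify a l in let v := nc_reify b l in
           constr:((u, v) :: acc) end
  end.

Ltac nc_hyps_proof hs acc :=
  lazymatch hs with
  | tt => acc
  | (?hs', ?h) =>
    let acc := nc_hyps_proof h acc in nc_hyps_proof hs' acc
  | _ => constr:(conj hs acc)
  end.

(** [hs] is one equation or a tuple of equations, each used from left to right; 20 is the number of
    rewriting rounds. *)
Ltac nc_tac hs :=
  lazymatch goal with
  | |- @eq ?T ?a ?b =>
    let l := nc_atoms a (@nil T) in
    let l := nc_atoms b l in
    let l := nc_hyps_atoms hs l in
    let u := nc_reify a l in
    let v := nc_reify b l in
    let rs := nc_hyps_rules hs l (@nil (NCRing.expr * NCRing.expr)) in
    let pf := nc_hyps_proof hs I in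
    refine (@NCRing.checkP _ l 20 rs u v pf _); vm_compute; reflexivity
  end.

Tactic Notation "nc" constr(hs) := nc_tac hs.
Tactic Notation "nc" := nc_tac tt.

(** * Locally matrix algebras *)

Section MatrixFacts.
Variables (F : fieldType) (n : nat).
Implicit Types a e : 'M[F]_n.+1.

Lemma delta_mx_sandwich a (i j k l : 'I_n.+1) :
  delta_mx i j *m a *m delta_mx k l = a j k *: delta_mx i l.
Proof.
apply/matrixP=> x y; rewrite !mxE (bigD1 k) //= big1 => [|z zk]; last first.
  by rewrite !mxE (negPf zk) mulr0.
rewrite addr0 !mxE (bigD1 j) //= big1 => [|z zj]; last first.
  by rewrite !mxE (negPf zj) andbF mul0r.
rewrite addr0 !mxE !eqxx andbT mulrAC -natrM mulnb mulrC.
by [].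
Qed.

Lemma sum_delta_mx_diag : \sum_l delta_mx l l = 1 :> 'M[F]_n.+1.
Proof. by rewrite -[RHS]/(1%:M) mx1_sum_delta. Qed.

(** A rank factorisation [e = C D] with [D C = 1] identifies the corner at [e] with a full matrix
    algebra. There Gaussian elimination gives [D a C = L P U] with [P] idempotent, whence [p] comes
    from [L P L^-1] and [u] from [L U]. *)
Lemma mx_unit_regular_corner e a : e * e = e -> e * a * e = a ->
  exists p u v, [/\ p * p = p, e * p * e = p, e * u * e = u, e * v * e = v
                  & [/\ u * v = e, v * u = e & a = p * u]].
Proof.
move=> ee eae.
have [r [C [D [CD DC]]]] : exists r (C : 'M_(n.+1, r)) (D : 'M_(r, n.+1)),
    C *m D = e /\ D *m C = 1%:M.
  have /row_fullP[C' CK] := col_base_full e.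
  have /row_freeP[D' DK] := row_base_free e.
  exists (\rank e), (col_base e), (row_base e); split; first exact: mulmx_base.
  move: (mulmx_base e) CK DK; move: (col_base e) (row_base e) => C D CD CK DK.
  (* Cancelling the outer full-rank factors in [C D C D = C D] leaves [D C = 1]. *)
  have : C' *m (C *m D *m (C *m D)) *m D' = C' *m (C *m D) *m D'.
    by rewrite CD -[e *m e]/(e * e) ee.
  by rewrite !mulmxA CK !mul1mx -!(mulmxA _ D) DK mulmx1.
have [L [P [U [LU Lu Uu PP]]]] : exists L P U : 'M_r,
    [/\ L *m P *m U = D *m a *m C, L \in unitmx, U \in unitmx & P *m P = P].
  exists (col_ebase (D *m a *m C)), (pid_mx (\rank (D *m a *m C))), (row_ebase (D *m a *m C)).
  split; [exact: mulmx_ebase|exact: col_ebase_unit|exact: row_ebase_unit|].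
  by rewrite mul_pid_mx minnn (minn_idPr _) ?rank_leq_row.
have e_in X : e *m (C *m X *m D) *m e = C *m X *m D.
  by rewrite -CD !mulmxA -(mulmxA C D C) DC mulmx1 -!mulmxA (mulmxA D C D) DC mul1mx.
have CXD X Y : C *m X *m D *m (C *m Y *m D) = C *m (X *m Y) *m D.
  by rewrite !mulmxA -(mulmxA (C *m X) D C) DC mulmx1.
exists (C *m (L *m P *m invmx L) *m D), (C *m (L *m U) *m D), (C *m (invmx U *m invmx L) *m D).
split; rewrite -?[_ * _]/(_ *m _) ?e_in //.
  rewrite CXD; congr (_ *m _ *m _).
  by rewrite !mulmxA mulmxKV // -(mulmxA L P P) PP.
split; rewrite CXD.
- by rewrite -!mulmxA mulKVmx // mulKVmx.
- by rewrite -!mulmxA mulKmx // mulKmx.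
have -> : L *m P *m invmx L *m (L *m U) = D *m a *m C by rewrite mulmxA mulmxKV.
by rewrite !mulmxA CD -!mulmxA CD !mulmxA.
Qed.

End MatrixFacts.

Section LocallyMatrix.
Variables (F : fieldType) (A : unitAlgType F).
Hypothesis lmA : unital_locally_matrix A.

(** The map [i] is the inverse of the given isomorphism followed by the inclusion into [A]; through
    it, computations with finitely many elements are carried out on matrices. *)
Lemma local_embedding (s : seq A) :
  exists n (i : 'M[F]_n.+1 -> A),
    [/\ i 1 = 1, i 0 = 0, {morph i : x y / x + y}, {morph i : x y / x * y}
      & forall c, {morph i : x / c *: x}] /\
    [/\ injective i, forall f : 'I_n.+1 -> 'M_n.+1, i (\sum_l f l) = \sum_l i (f l)
      & {in s, forall a, exists m, a = i m}].
Proof.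
have [S [A' [_ sS [n [f [g fK gK]]]]]] := lmA s.
have gE m x : f x = m -> g m = x by move=> <-; rewrite fK.
have gD : {morph (fun m => val (g m)) : x y / x + y}.
  move=> x y; rewrite (gE _ (g x + g y)) ?raddfD //.
  by congr (_ + _); exact: gK.
have g0 : val (g 0) = 0 by rewrite (gE _ 0) ?raddf0.
exists n, (fun m => val (g m)); split; split=> //.
- by rewrite (gE _ 1) ?rmorph1.
- move=> x y; rewrite (gE _ (g x * g y)) ?rmorphM //.
  by congr (_ * _); exact: gK.
- move=> c x; rewrite (gE _ (c *: g x)) ?linearZ //.
  by congr (_ *: _); exact: gK.
- by apply: inj_comp (can_inj gK); exact: val_inj.
- by move=> h; exact: (big_morph _ gD g0).
move=> a sa; have Sa := sS _ sa.
by exists (f (Sub a Sa)); rewrite fK SubK.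
Qed.

(** Simplicity of [A]: for a nonzero entry [m j k], the sum over [l] of [E_lj m E_kl] is [m j k]
    times the identity. *)
Lemma simple_unit (a : A) : a != 0 ->
  exists s : seq (A * A), \sum_(p <- s) p.1 * a * p.2 = 1.
Proof.
move=> a0; have [n [i [[i1 i0 iD iM iZ] [i_inj isum iS]]]] := local_embedding [:: a].
have [m am] := iS a (mem_head _ _).
have /matrix0Pn[j [k mjk]] : m != 0 by apply: contraNneq a0 => m0; rewrite am m0 i0.
exists [seq (i ((m j k)^-1 *: delta_mx l j), i (delta_mx k l)) | l <- enum 'I_n.+1].
rewrite big_map big_enum /= -i1 -sum_delta_mx_diag isum.
apply: eq_bigr => l _; rewrite am -!iM; congr i.
rewrite -[_ * _ * _]/(_ *m _ *m _) -!scalemxAl delta_mx_sandwich scalerA mulVf //.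
by rewrite scale1r.
Qed.

Lemma prime_alg (a b : A) : (forall x, a * x * b = 0) -> a = 0 \/ b = 0.
Proof.
move=> ab; case: (eqVneq b 0) => [->|b0]; first by right.
left; have [s s1] := simple_unit b0.
rewrite -[a]mulr1 -s1 mulr_sumr big1 // => p _.
by rewrite !mulrA ab mul0r.
Qed.

(* In a matrix algebra containing [a] and [s], take [r = a E_ll]. *)
Lemma rank_one_sum (a : A) (s : seq A) :
  exists rs : seq A, a = \sum_(r <- rs) r /\
    forall r x, r \in rs -> x \in s -> exists c : F, r * x * r = c *: r.
Proof.
have [n [i [[i1 i0 iD iM iZ] [i_inj isum iS]]]] := local_embedding (a :: s).
have [m am] := iS a (mem_head _ _).
exists [seq a * i (delta_mx l l) | l <- enum 'I_n.+1]; split.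
  by rewrite big_map big_enum /= -mulr_sumr -isum sum_delta_mx_diag i1 mulr1.
move=> r x /mapP[l _ ->] sx.
have [y xy] : exists y, x = i y by apply: iS; rewrite in_cons sx orbT.
rewrite am xy -!iM.
exists ((y * m) l l); rewrite -iZ; congr i.
have dd : delta_mx l l * (y * m) * delta_mx l l = (y * m) l l *: delta_mx l l.
  exact: delta_mx_sandwich.
by rewrite scalerAr -dd !mulrA.
Qed.

(** If [m j k] is nonzero, a multiple [d] of [E_kj] satisfies [d m d = d], so [m d m] is a rank-one
    idempotent below [m], and compressing by it yields scalars. *)
Lemma small_idempotent (e z : A) : e * e = e -> e != 0 ->
  exists g, [/\ g != 0, g * g = g, e * g = g, g * e = g
              & exists c : F, g * z * g = c *: g].
Proof.
move=> ee e0; have [n [i [[i1 i0 iD iM iZ] [i_inj isum iS]]]] := local_embedding [:: e; z].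
have [m em] := iS e (mem_head _ _).
have [y zy] : exists y, z = i y by apply: iS; rewrite !inE eqxx orbT.
have /matrix0Pn[j [k mjk]] : m != 0 by apply: contraNneq e0 => m0; rewrite em m0 i0.
pose d := (m j k)^-1 *: delta_mx k j : 'M[F]_n.+1.
have dxd x : d * x * d = (x j k / m j k) *: d.
  rewrite -2!scalerAl -scalerAr [delta_mx k j * _ * _]delta_mx_sandwich.
  by rewrite /d !scalerA; congr (_ *: _); field; rewrite mjk.
have mm : m * m = m by apply: i_inj; rewrite iM -em.
have dmd : d * m * d = d by rewrite dxd divff // scale1r.
exists (i (m * d * m)); split.
- rewrite -i0 (inj_eq i_inj); apply: contraNneq mjk => g0.
  have: d = 0 by rewrite -dmd -{1}dmd -{1}mm -[LHS]mulr1; nc g0.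
  move/eqP; rewrite scaler_eq0 invr_eq0 => /orP[//|/eqP/matrixP/(_ k j)/eqP].
  by rewrite !mxE !eqxx oner_eq0.
- by rewrite -iM; congr i; nc (mm, dmd).
- by rewrite em -iM !mulrA mm.
- by rewrite em -iM -!mulrA mm.
exists ((m * y * m) j k / m j k); rewrite zy -!iM -iZ; congr i.
by rewrite scalerAl scalerAr -dxd !mulrA.
Qed.

Lemma unit_regular_corner (e a : A) : e * e = e -> e * a * e = a ->
  exists p u v, [/\ p * p = p, e * p * e = p, e * u * e = u, e * v * e = v
                  & [/\ u * v = e, v * u = e & a = p * u]].
Proof.
move=> ee eae; have [n [i [[i1 i0 iD iM iZ] [i_inj isum iS]]]] := local_embedding [:: e; a].
have [m em] := iS e (mem_head _ _).
have [y ay] : exists y, a = i y by apply: iS; rewrite !inE eqxx orbT.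
have [||p [u [v [pp epe eue eve [uv vu pu]]]]] := @mx_unit_regular_corner _ _ m y.
- by apply: i_inj; rewrite iM -em.
- by apply: i_inj; rewrite !iM -em -ay.
exists (i p), (i u), (i v).
by split; [..|split]; rewrite ?em ?ay -!iM ?pp ?epe ?eue ?eve ?uv ?vu ?pu.
Qed.

(** Without nontrivial idempotents the matrix unit [E_00] equals 1 in every local matrix algebra,
    which therefore has size one. *)
Lemma scalar_or_idempotent :
  (forall a : A, exists c : F, a = c%:A) \/
  (exists e : A, [/\ e * e = e, e != 0 & e != 1]).
Proof.
case: (pselect (exists e : A, [/\ e * e = e, e != 0 & e != 1])) => [|noe]; first by right.
left=> a; have [n [i [[i1 i0 iD iM iZ] [i_inj isum iS]]]] := local_embedding [:: a].
have [m ->] := iS a (mem_head _ _).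
have d1 : delta_mx ord0 ord0 = 1 :> 'M[F]_n.+1.
  apply: contrapT => d1; apply: noe; exists (i (delta_mx ord0 ord0)); split.
  - by rewrite -iM -[_ * _]/(_ *m _) mul_delta_mx.
  - rewrite -i0 (inj_eq i_inj); apply/eqP => /matrixP/(_ ord0 ord0)/eqP.
    by rewrite !mxE oner_eq0.
  - by rewrite -i1 (inj_eq i_inj); apply/eqP.
exists (m ord0 ord0); rewrite -i1 -iZ; congr i.
by rewrite -[LHS]mulr1 -[LHS]mul1r mulrA -d1; exact: delta_mx_sandwich.
Qed.

End LocallyMatrix.

(** * Corners and commuting unipotents *)

Section Corners.
Variables (F : fieldType) (A : unitAlgType F).
Hypotheses (char_not2 : 2%N \notin [pchar F]) (char_not3 : 3%N \notin [pchar F]).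
Hypothesis lmA : unital_locally_matrix A.
Implicit Types a b c e x y z u v w : A.

Lemma two_neq0 : 2%:R != 0 :> F.
Proof. by apply: contra char_not2 => two0; rewrite inE. Qed.

Lemma three_neq0 : 3%:R != 0 :> F.
Proof. by apply: contra char_not3 => three0; rewrite inE. Qed.

Lemma mulrn2_inj : injective (fun x => x *+ 2).
Proof. by move=> x y /=; rewrite -!scaler_nat => /(scalerI two_neq0). Qed.

Lemma mulrn3_inj : injective (fun x => x *+ 3).
Proof. by move=> x y /=; rewrite -!scaler_nat => /(scalerI three_neq0). Qed.

Lemma scale_half_double x : (2%:R^-1 *: x) *+ 2 = x.
Proof. by rewrite -scaler_nat scalerA divff ?two_neq0 // scale1r. Qed.

Lemma unitrI a b : a * b = 1 -> b * a = 1 -> a \is a GRing.unit.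
Proof. by move=> ab ba; apply/unitrP; exists b. Qed.

Lemma unit_1D_square0 x : x * x = 0 -> 1 + x \is a GRing.unit.
Proof. by move=> xx; apply: (@unitrI _ (1 - x)); nc xx. Qed.

(** For [c = 0] the unit is [1 + x]; otherwise it is the reflection [1 - (2 / c) x], of square 1. *)
Lemma quasi_idempotent_unit (c : F) x : x * x = c *: x ->
  exists p : F * A, [/\ p.2 \is a GRing.unit, x = p.1 *: (p.2 - 1)
                      & exists d : F, p.2 = 1 + d *: x].
Proof.
move=> xx; case: (eqVneq c 0) => [c0|c_neq0].
  exists (1, 1 + x); split => /=; last by exists 1; rewrite scale1r.
    by apply: unit_1D_square0; rewrite xx c0 scale0r.
  by rewrite scale1r addrC addKr.
exists (- (c / 2%:R), 1 - (2%:R / c) *: x); split => /=.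
- have sq : (2%:R / c *: x) * (2%:R / c *: x) = (2%:R / c *: x) *+ 2.
    rewrite -scalerAl -scalerAr xx !scalerA -scaler_nat scalerA.
    by congr (_ *: _); field; rewrite c_neq0.
  by apply: (@unitrI _ (1 - 2%:R / c *: x)); nc sq.
- rewrite addrAC subrr add0r scaleNr scalerN opprK scalerA -[LHS]scale1r.
  by congr (_ *: _); field; rewrite c_neq0 two_neq0.
by exists (- (2%:R / c)); rewrite scaleNr.
Qed.

(** Rank-one summands [r] of [a] satisfy [r e r = c r], so [quasi_idempotent_unit] applies to each
    [e r e]. Linear conditions on the corner can thus be tested on units that are trivial on the
    complement. *)
Lemma corner_span e a : e * e = e ->
  exists s : seq (F * A), e * a * e = \sum_(p <- s) p.1 *: (p.2 - 1) /\
    forall p, p \in s -> [/\ p.2 \is a GRing.unit, (1 - e) * p.2 = 1 - e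
                           & p.2 * (1 - e) = 1 - e].
Proof.
move=> ee; have [rs [-> rsP]] := rank_one_sum lmA a [:: e].
elim: rs rsP => [|r rs IH] rsP.
  by exists [::]; rewrite !big_nil mulr0 mul0r.
have [|s [sE sP]] := IH; first by move=> x y xrs; apply: rsP; rewrite in_cons xrs orbT.
have [c rer] := rsP r e (mem_head _ _) (mem_head _ _).
have [|p [pu pE [d pd]]] := @quasi_idempotent_unit c (e * r * e).
  have -> : e * r * e * (e * r * e) = e * (r * e * r) * e by nc ee.
  by rewrite rer -scalerAr -scalerAl.
exists (p :: s); split; first by rewrite !big_cons mulrDr mulrDl sE -pE.
move=> q; rewrite in_cons => /predU1P[->|]; last exact: sP.
have l0 : (1 - e) * (e * r * e) = 0 by nc ee.
have r0 : e * r * e * (1 - e) = 0 by nc ee.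
split=> //; rewrite pd.
  by rewrite mulrDr mulr1 -scalerAr l0 scaler0 addr0.
by rewrite mulrDl mul1r -scalerAl r0 scaler0 addr0.
Qed.

Lemma fix_compl_commute e w : (1 - e) * w = 1 - e -> w * (1 - e) = 1 - e ->
  w * e = e * w.
Proof.
move=> ew we; have : (1 - e) * w = w * (1 - e) by rewrite ew we.
by rewrite mulrBl mulrBr mul1r mulr1 => /addrI/oppr_inj.
Qed.

Lemma commute_corner e z : e * e = e ->
  (forall w, w \is a GRing.unit -> w * e = e * w -> z * w = w * z) ->
  forall a, z * (e * a * e) = e * a * e * z.
Proof.
move=> ee zC a; have [s [-> sP]] := corner_span a ee.
rewrite mulr_sumr mulr_suml; apply: eq_big_seq => p /sP[pu pe ep].
rewrite -scalerAr -scalerAl mulrBr mulrBl mulr1 mul1r zC //.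
exact: fix_compl_commute.
Qed.

(** A small idempotent [g] below [e] gives [z g = c g]. Since [z] commutes with the corner,
    [z - c e] annihilates every [x g], and primeness gives [z = c e]. *)
Lemma corner_center e z : e * e = e -> e != 0 -> e * z = z -> z * e = z ->
  (forall w, w \is a GRing.unit -> w * e = e * w -> z * w = w * z) ->
  exists c : F, z = c *: e.
Proof.
move=> ee e0 ez ze zC; have zce := commute_corner ee zC.
have [g [g0 gg eg ge [c gzg]]] := small_idempotent lmA z ee e0.
have zg : z * g = c *: g.
  have ege : e * g * e = g by rewrite eg ge.
  by rewrite -gzg -{1}gg mulrA -{1}ege zce ege.
exists c; apply: subr0_eq.
suff /(prime_alg lmA)[//|g_eq0] : forall x, (z - c *: e) * x * g = 0.
  by rewrite g_eq0 eqxx in g0.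
move=> x; have -> : (z - c *: e) * x * g = (z - c *: e) * (e * x * e) * g.
  have zcE : (z - c *: e) * e = z - c *: e by rewrite mulrBl ze -scalerAl ee.
  by rewrite !mulrA zcE -[in RHS]mulrA eg.
rewrite !mulrBl zce -scalerAl -scalerAl [e * (e * x * e)](_ : _ = e * x * e); last by nc ee.
by rewrite -(mulrA _ z g) zg -scalerAr subrr.
Qed.

Lemma center_scalar z :
  (forall w, w \is a GRing.unit -> z * w = w * z) -> exists c : F, z = c%:A.
Proof.
move=> zC; apply: corner_center; rewrite ?mul1r ?mulr1 ?oner_neq0 //.
by move=> w wu _; exact: zC.
Qed.

(** * Commutative subgroups inverted by an involution *)

Section CommutingUnipotents.
Variables (e : A) (U : A -> Prop).
Hypothesis ee : e * e = e.
Hypothesis UC : forall u v, U u -> U v -> u * v = v * u.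
Hypothesis UJ : forall u d, U u -> d \is a GRing.unit -> d * e = e * d ->
  U (d * u * d^-1).
Hypothesis U_inverted : forall u, U u ->
  (1 - e *+ 2) * u * (1 - e *+ 2) * u = 1.
Hypothesis U_square : forall u, U u -> exists2 v, U v & u = v * v.

(* [1 + e] conjugates [u] into [(1 + e) u (1 - e/2)], since [char F <> 2]. *)
Lemma commute_dilated u v : U u -> U v ->
  u * ((1 + e) * v * (1 *+ 2 - e)) = (1 + e) * v * (1 *+ 2 - e) * u.
Proof.
move=> Uu Uv.
have d2 : (1 + e) * (1 *+ 2 - e) = 1 *+ 2 by nc ee.
have d2' : (1 *+ 2 - e) * (1 + e) = 1 *+ 2 by nc ee.
have du : 1 + e \is a GRing.unit.
  apply: (@unitrI _ (2%:R^-1 *: (1 *+ 2 - e))).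
    by rewrite -scalerAr d2 -scaler_nat scalerA mulVf ?two_neq0 ?scale1r.
  by rewrite -scalerAl d2' -scaler_nat scalerA mulVf ?two_neq0 ?scale1r.
have -> : 1 *+ 2 - e = (1 + e)^-1 *+ 2.
  by rewrite -[LHS](mulKr du) d2 mulrnAr mulr1.
rewrite !(mulrnAr, mulrnAl); congr (_ *+ 2).
by apply: UC => //; apply: UJ => //; nc.
Qed.

(** Commutation with the dilated conjugate kills the products of opposite off-diagonal blocks of
    [u], and inversion makes its diagonal blocks square to the identity; so [u * u] has trivial
    diagonal. *)
Lemma square_blocks u : U u ->
  exists b c, [/\ u * u = 1 + e * b * (1 - e) + (1 - e) * c * e,
    e * b * (1 - e) * ((1 - e) * c * e) = 0 & (1 - e) * c * e * (e * b * (1 - e)) = 0].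
Proof.
move=> Uu; have comm := commute_dilated Uu Uu; have inv := U_inverted Uu.
pose f := 1 - e.
have ff : f * f = f by rewrite /f; nc ee.
have ef : e * f = 0 by rewrite /f; nc ee.
have fe : f * e = 0 by rewrite /f; nc ee.
have e1 : 1 = e + f by rewrite /f addrC subrK.
(* The blocks [ee], [ef], [fe], [ff] of [V] are 2, 4, 1, 2 times those of [u]. Each block of
   [u V = V u] is one of the next four relations, up to sign and a factor 1, 2 or 3. *)
set V := (1 + e) * u * (1 *+ 2 - e) in comm.
have efe : e * u * f * u * e = 0.
  apply: mulrn3_inj; rewrite /= [LHS](_ : _ = - (e * (u * V - V * u) * e)).
    by rewrite comm subrr mulr0 mul0r oppr0 mul0rn.
  by rewrite /V /f; nc ee.
have fef : f * u * e * u * f = 0.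
  apply: mulrn3_inj; rewrite /= [LHS](_ : _ = f * (u * V - V * u) * f).
    by rewrite comm subrr mulr0 mul0r mul0rn.
  by rewrite /V /f; nc ee.
have eef : e * u * e * u * f = e * u * f * u * f.
  apply: subr0_eq; apply: mulrn2_inj; rewrite /= [LHS](_ : _ = e * (u * V - V * u) * f).
    by rewrite comm subrr mulr0 mul0r mul0rn.
  by rewrite /V /f; nc ee.
have fee : f * u * e * u * e = f * u * f * u * e.
  apply: subr0_eq; rewrite /= [LHS](_ : _ = f * (u * V - V * u) * e).
    by rewrite comm subrr mulr0 mul0r.
  by rewrite /V /f; nc ee.
have eee : e * u * e * u * e = e.
  have -> : e * u * e * u * e =
      e * ((1 - e *+ 2) * u * (1 - e *+ 2) * u) * e + e * u * f * u * e.
    by rewrite /f; nc ee.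
  by rewrite inv efe mulr1 ee addr0.
have fff : f * u * f * u * f = f.
  have -> : f * u * f * u * f =
      f * ((1 - e *+ 2) * u * (1 - e *+ 2) * u) * f + f * u * e * u * f.
    by rewrite /f; nc ee.
  by rewrite inv fef mulr1 ff addr0.
have uu : u * u = (e + f) * u * (e + f) * u * (e + f) by rewrite -e1 !mul1r !mulr1.
exists (u * u), (u * u); rewrite -/f; split.
- by rewrite [in LHS]uu [in RHS]uu [in RHS]e1; nc (ee, ff, ef, fe, efe, fef, eee, fff).
- by rewrite !uu; nc (ee, ff, ef, fe, efe, fef, esym eef, esym fee).
- by rewrite !uu; nc (ee, ff, ef, fe, efe, fef, eef, fee).
Qed.

(** Every element of [U] is a square, hence [1 + b + c] with [b] and [c] in the two off-diagonal
    blocks. Commutation with conjugates by units of the complementary corner gives [b a c' = 0] for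
    all [a], so by primeness one nonzero [b] forces every [c'] to vanish. *)
Lemma unipotent_dichotomy :
  (forall u, U u -> exists x, u = 1 + e * x * (1 - e)) \/
  (forall u, U u -> exists x, u = 1 + (1 - e) * x * e).
Proof.
pose f := 1 - e.
have ff : f * f = f by rewrite /f; nc ee.
have ef : e * f = 0 by rewrite /f; nc ee.
have fe : f * e = 0 by rewrite /f; nc ee.
have blocks u : U u -> u = 1 + e * u * f + f * u * e.
  case/U_square=> v /square_blocks[b [c [vv _ _]]] ->.
  by rewrite -/f in vv; rewrite vv; nc (ee, ff, ef, fe).
have bc0 u v : U u -> U v -> e * u * f * v * e = 0.
  move=> Uu Uv; have comm := commute_dilated Uu Uv; have comm' := UC Uu Uv.
  set V := (1 + e) * v * (1 *+ 2 - e) in comm.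
  have uE := blocks u Uu; have vE := blocks v Uv.
  apply: mulrn3_inj => /=; rewrite mul0rn.
  (* This combination cancels [e v f u e] and leaves three times [e u f v e]. *)
  transitivity (e * (u * v - v * u) * e *+ 4 - e * (u * V - V * u) * e).
    by rewrite /V uE vE /f; nc ee.
  by rewrite comm comm' !subrr mulr0 mul0r mul0rn subr0.
have bac0 u v a : U u -> U v -> e * u * f * a * (f * v * e) = 0.
  move=> Uu Uv; have -> : e * u * f * a * (f * v * e) = e * u * (f * a * f) * v * e by nc ff.
  have [s [-> sP]] := corner_span a ff.
  rewrite !(mulr_sumr, mulr_suml) big_seq big1 // => p /sP[wu].
  have -> : 1 - f = e by rewrite /f opprB addrC subrK.
  move=> ew we; rewrite -!(scalerAr, scalerAl).
  have we' : p.2 * e = e * p.2 by rewrite ew we.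
  have := bc0 u (p.2 * v * p.2^-1) Uu (UJ Uv wu we').
  have -> : e * u * f * (p.2 * v * p.2^-1) * e = e * u * f * p.2 * v * e.
    by rewrite -!mulrA -[in p.2^-1 * e]we mulKr.
  move=> w0; have -> : e * u * (p.2 - 1) * v * e = e * u * f * p.2 * v * e - e * u * f * v * e.
    rewrite /f; nc ew.
  by rewrite w0 (bc0 u v) // subrr scaler0.
case: (pselect (exists2 u, U u & e * u * f != 0)) => [[u Uu b0]|nb].
  left=> v Uv; exists v; rewrite -/f {1}(blocks v Uv).
  have [b_eq0|->] := prime_alg lmA (fun a => bac0 u v a Uu Uv); last by rewrite addr0.
  by rewrite b_eq0 eqxx in b0.
right=> v Uv; exists v; rewrite -/f {1}(blocks v Uv).
have -> : e * v * f = 0 by apply/eqP; apply: contrapT => /negP b0; apply: nb; exists v.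
by rewrite addr0.
Qed.

End CommutingUnipotents.

End Corners.

(** * Images of the root subgroups *)

(* The unit groups enter through maps on all of [R] and [S]; the values of [P] and
   [Q] at non-units are irrelevant. *)
Record group_iso (R S : unitRingType) (P : R -> S) (Q : S -> R) : Prop := {
  gi_unit : forall a, a \is a GRing.unit -> P a \is a GRing.unit;
  gi_unitV : forall b, b \is a GRing.unit -> Q b \is a GRing.unit;
  gi_mul : {in GRing.unit &, {morph P : a b / a * b}};
  gi_mulV : {in GRing.unit &, {morph Q : a b / a * b}};
  gi_K : {in GRing.unit, cancel P Q};
  gi_VK : {in GRing.unit, cancel Q P} }.

Lemma group_iso_sym (R S : unitRingType) (P : R -> S) (Q : S -> R) :
  group_iso P Q -> group_iso Q P.
Proof. by case. Qed.

Section GroupIsoTheory.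
Variables (R S : unitRingType) (P : R -> S) (Q : S -> R).
Hypothesis PQ : group_iso P Q.

Lemma gi1 : P 1 = 1.
Proof.
apply: (mulrI (gi_unit PQ (unitr1 R))).
by rewrite -(gi_mul PQ) ?unitr1 ?mulr1.
Qed.

Lemma giV a : a \is a GRing.unit -> P a^-1 = (P a)^-1.
Proof.
move=> au; apply: (mulrI (gi_unit PQ au)).
by rewrite -(gi_mul PQ) ?unitrV // mulrV // gi1 mulrV // (gi_unit PQ).
Qed.

Lemma gi_inj : {in GRing.unit &, injective P}.
Proof. exact: can_in_inj (gi_K PQ). Qed.

End GroupIsoTheory.

(** Keeping both idempotents makes the notion symmetric, so that a statement about one off-diagonal
    block also serves the other. *)
Record frame (R : pzRingType) (e f : R) : Prop := {
  fr_l : e * e = e; fr_r : f * f = f; fr_lr : e * f = 0; fr_rl : f * e = 0;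
  fr_1 : e + f = 1; fr_l0 : e != 0; fr_r0 : f != 0 }.

Lemma frame_sym (R : pzRingType) (e f : R) : frame e f -> frame f e.
Proof. by case=> *; split=> //; rewrite addrC. Qed.

Lemma frame_compl (R : pzRingType) (e : R) :
  e * e = e -> e != 0 -> e != 1 -> frame e (1 - e).
Proof.
move=> ee e0 e1; split=> //; first [nc ee | by rewrite addrC subrK | idtac].
by rewrite subr_eq0 eq_sym.
Qed.

Lemma frame_rE (R : pzRingType) (e f : R) : frame e f -> f = 1 - e.
Proof. by move=> fr; rewrite -(fr_1 fr) addrAC subrr add0r. Qed.

(** Only inclusions are recorded; surjectivity onto the blocks comes from the inverse map being
    matched as well. *)
Record matched (R S : unitRingType) (P : R -> S) (e f : R) (e' f' : S) : Prop := {
  mt_lr : forall x, exists y, P (1 + e * x * f) = 1 + e' * y * f';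
  mt_rl : forall x, exists y, P (1 + f * x * e) = 1 + f' * y * e';
  mt_C : forall w, w \is a GRing.unit -> w * e = e * w -> P w * e' = e' * P w }.

Lemma matched_sym (R S : unitRingType) (P : R -> S) (e f : R) (e' f' : S) :
  frame e f -> frame e' f' -> matched P e f e' f' -> matched P f e f' e'.
Proof.
move=> fr fr' [lr rl C]; split=> // w wu wf.
rewrite (frame_rE fr') mulrBr mulrBl C ?mulr1 ?mul1r //.
by rewrite (frame_rE (frame_sym fr)) mulrBr mulrBl mulr1 mul1r wf.
Qed.

Section TwoAlgebras.
Variables (F : fieldType).
Hypotheses (char_not2 : 2%N \notin [pchar F]) (char_not3 : 3%N \notin [pchar F]).

Section Image.
Variables (A B : unitAlgType F).
Hypotheses (lmA : unital_locally_matrix A) (lmB : unital_locally_matrix B).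
Variables (P : A -> B) (Q : B -> A).
Hypothesis PQ : group_iso P Q.

Lemma involution_unit (R : unitRingType) (e : R) : e * e = e -> 1 - e *+ 2 \is a GRing.unit.
Proof. by move=> ee; apply/unitrP; exists (1 - e *+ 2); split; nc ee. Qed.

Lemma block_unit (R : unitRingType) (e f : R) x : frame e f ->
  1 + e * x * f \is a GRing.unit.
Proof.
case=> ee ff ef fe _ _ _; apply/unitrP; exists (1 - e * x * f).
by split; nc (ee, ff, ef, fe).
Qed.

(** The image of -1 is central, hence a scalar of square 1, and it differs from 1 by injectivity and
    [char_not2]. *)
Lemma giN1 : P (- 1) = - 1.
Proof.
have uN1 : (-1 : A) \is a GRing.unit by rewrite unitrN unitr1.
have [|c PN1] := center_scalar char_not2 lmB (z := P (-1)).
  move=> w wu; rewrite -(gi_VK PQ wu) -!(gi_mul PQ) ?(gi_unitV PQ) //.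
  by rewrite mulN1r mulrN1.
have : (c + 1) * (c - 1) == 0.
  have : (c * c - 1)%:A = 0 :> B.
    transitivity (P (-1) * P (-1) - 1).
      by rewrite PN1 -scalerAl mul1r scalerA scalerBl scale1r.
    by rewrite -(gi_mul PQ) // mulN1r opprK (gi1 PQ) subrr.
  move/eqP; rewrite scaler_eq0 oner_eq0 orbF => /eqP cc.
  by apply/eqP; rewrite -cc; ring.
rewrite mulf_eq0 => /orP[|].
  by rewrite addr_eq0 => /eqP c1; rewrite PN1 c1 scaleN1r.
rewrite subr_eq0 => /eqP c1; move: PN1; rewrite c1 scale1r -(gi1 PQ).
move/(gi_inj PQ uN1 (unitr1 _)) => N11.
have /eqP := two_neq0 char_not2; case; apply/eqP.
have : (2%:R : F)%:A = 0 :> A by rewrite scaler_nat -[1 *+ 2]/(1 + 1) -{1}N11 addNr.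
by move/eqP; rewrite scaler_eq0 oner_eq0 orbF.
Qed.

Lemma giN a : a \is a GRing.unit -> P (- a) = - P a.
Proof.
by move=> au; rewrite -mulN1r (gi_mul PQ) ?giN1 ?mulN1r // unitrN unitr1.
Qed.

Lemma image_idempotent (e : A) : e * e = e -> e != 0 -> e != 1 ->
  exists e' : B, [/\ e' * e' = e', e' != 0, e' != 1 & P (1 - e *+ 2) = 1 - e' *+ 2].
Proof.
move=> ee e0 e1; have tu := involution_unit ee.
set T := P (1 - e *+ 2); have TT : T * T = 1.
  rewrite -(gi_mul PQ) // -(gi1 PQ); congr P; nc ee.
pose e' := 2%:R^-1 *: (1 - T).
have e'2 : e' *+ 2 = 1 - T := scale_half_double char_not2 _.
have TE : T = 1 - e' *+ 2 by rewrite e'2 opprB addrC subrK.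
have e'e' : e' * e' = e'.
  apply: (mulrn2_inj char_not2); apply: (mulrn2_inj char_not2) => /=.
  transitivity ((e' *+ 2) * (e' *+ 2)); first by nc.
  transitivity ((e' *+ 2) *+ 2); last by nc.
  by rewrite e'2; nc TT.
have t1 : 1 - e *+ 2 = 1 -> e = 0.
  move=> h; apply: (mulrn2_inj char_not2) => /=; rewrite mul0rn.
  by apply: oppr_inj; apply: (addrI 1); rewrite h oppr0 addr0.
exists e'; split=> //.
  apply: contraNneq e0 => e'0; apply/eqP/t1/(gi_inj PQ tu (unitr1 _)).
  by rewrite -/T TE e'0 mul0rn subr0 (gi1 PQ).
apply: contraNneq e1 => e'1.
have : 1 - e *+ 2 = -1.
  apply: (gi_inj PQ tu); first by rewrite unitrN unitr1.
  by rewrite -/T TE e'1 giN1; nc.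
move=> h; apply/eqP; apply: (mulrn2_inj char_not2) => /=.
by apply: oppr_inj; apply: (addrI 1); rewrite h; nc.
Qed.

Lemma block_dichotomy (e f : A) (e' f' : B) : frame e f -> frame e' f' ->
  P (1 - e *+ 2) = 1 - e' *+ 2 ->
  (forall x, exists y, P (1 + e * x * f) = 1 + e' * y * f') \/
  (forall x, exists y, P (1 + e * x * f) = 1 + f' * y * e').
Proof.
move=> fr fr' Pt; have [ee ff ef fe e1 _ _] := fr; have e'e' := fr_l fr'.
have bu x := block_unit x fr; have tu := involution_unit ee.
pose U v := exists x, v = P (1 + e * x * f).
have [||||H|H] := @unipotent_dichotomy _ _ char_not2 char_not3 lmB e' U e'e'.
- move=> u v [x ->] [y ->]; rewrite -!(gi_mul PQ) //; congr P.
  by nc (ee, ff, ef, fe).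
(* Conjugation by [d] is pulled back to [d0], which commutes with [e] because [d] commutes with the
   image of [1 - e *+ 2]. *)
- move=> u d [x ->] du de'; set d0 := Q d.
  have d0u : d0 \is a GRing.unit by exact: (gi_unitV PQ).
  have d0e : d0 * e = e * d0.
    apply: (mulrn2_inj char_not2) => /=.
    suff : d0 * (1 - e *+ 2) = (1 - e *+ 2) * d0.
      by rewrite mulrBr mulrBl mulr1 mul1r => /addrI/oppr_inj; rewrite mulrnAr mulrnAl.
    apply: (gi_inj PQ); rewrite ?rpredM ?d0u // !(gi_mul PQ) //.
    by rewrite Pt (gi_VK PQ) //; nc de'.
  have d0f : d0 * f = f * d0.
    by rewrite (frame_rE fr) mulrBr mulrBl mulr1 mul1r d0e.
  exists (d0 * x * d0^-1); rewrite -[d](gi_VK PQ) // -/d0 -(giV PQ) //.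
  rewrite -!(gi_mul PQ) ?rpredM ?unitrV ?d0u ?bu //; congr P.
  rewrite mulrDr mulr1 mulrDl mulrV //; congr (_ + _).
  rewrite !mulrA d0e -!mulrA; congr (_ * (_ * (_ * _))).
  by apply: (mulrI d0u); rewrite mulVKr // mulrA d0f mulrK.
- move=> u [x ->]; rewrite -Pt -!(gi_mul PQ) ?rpredM ?tu ?bu // -(gi1 PQ); congr P.
  by nc (ee, ff, ef, fe).
(* Square roots are obtained by halving the block. *)
- move=> u [x ->]; exists (P (1 + e * (2%:R^-1 *: x) * f)); first by eexists.
  rewrite -(gi_mul PQ) //; congr P; rewrite -{1}[x](scale_half_double char_not2).
  by nc (ee, ff, ef, fe).
- left=> x; have [|y ->] := H (P (1 + e * x * f)); first by exists x.
  by exists y; rewrite (frame_rE fr').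
right=> x; have [|y ->] := H (P (1 + e * x * f)); first by exists x.
by exists y; rewrite (frame_rE fr').
Qed.

End Image.
End TwoAlgebras.

Section MatchedFrames.
Variables (F : fieldType).
Hypotheses (char_not2 : 2%N \notin [pchar F]) (char_not3 : 3%N \notin [pchar F]).

Lemma frame_block_neq0 (A : unitAlgType F) (lmA : unital_locally_matrix A) (e f : A) :
  frame e f -> ~ forall x, e * x * f = 0.
Proof.
by move=> fr /(prime_alg lmA)[] h; [move: (fr_l0 fr)|move: (fr_r0 fr)]; rewrite h eqxx.
Qed.

Section NoncommutingBlocks.
Variables (A B : unitAlgType F) (lmA : unital_locally_matrix A).
Variables (P : A -> B) (Q : B -> A) (PQ : group_iso P Q).
Variables (e f : A) (e' f' : B) (fr : frame e f) (fr' : frame e' f').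

(** Both images would lie in one commutative group, whereas the [e]-corner of the additive
    commutator of the preimages is [e x f y e]. *)
Lemma opposite_blocks_noncommuting :
  (forall x, exists y, P (1 + e * x * f) = 1 + e' * y * f') ->
  (forall x, exists y, P (1 + f * x * e) = 1 + e' * y * f') -> False.
Proof.
have [ee ff ef fe _ e0 _] := fr; have [e'e' f'f' e'f' f'e' _ _ _] := fr'.
move=> Plr Prl; apply: (frame_block_neq0 lmA fr) => x.
suff /(prime_alg lmA)[//|h] : forall y, e * x * f * y * e = 0 by rewrite h eqxx in e0.
move=> y; have ux := block_unit x fr; have uy := block_unit y (frame_sym fr).
have comm : (1 + e * x * f) * (1 + f * y * e) = (1 + f * y * e) * (1 + e * x * f).
  have [z Pz] := Plr x; have [t Pt] := Prl y.
  apply: (gi_inj PQ); rewrite ?rpredM // !(gi_mul PQ) // Pz Pt.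
  by nc (e'e', f'f', e'f', f'e').
transitivity (e * ((1 + e * x * f) * (1 + f * y * e) - (1 + f * y * e) * (1 + e * x * f)) * e).
  by nc (ee, ff, ef, fe).
by rewrite comm subrr mulr0 mul0r.
Qed.

Lemma block_not_flipped :
  (forall x, exists y, P (1 + e * x * f) = 1 + e' * y * f') ->
  (forall y, exists x, Q (1 + e' * y * f') = 1 + f * x * e) -> False.
Proof.
have [ee ff ef fe _ _ _] := fr.
move=> Plr Qlr; apply: (frame_block_neq0 lmA fr) => x.
have [y Py] := Plr x; have [z Qz] := Qlr y.
move: (gi_K PQ (block_unit x fr)); rewrite Py Qz => /addrI h.
have -> : e * x * f = e * (e * x * f) * f by nc (ee, ff).
by rewrite -h; nc (ee, ff, ef).
Qed.

End NoncommutingBlocks.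

Section InvolutionImage.
Variables (A B : unitAlgType F).
Hypotheses (lmA : unital_locally_matrix A) (lmB : unital_locally_matrix B).
Variables (P : A -> B) (Q : B -> A).
Hypothesis PQ : group_iso P Q.

Lemma centralizer_image (e : A) (e' : B) w : e * e = e -> e' * e' = e' ->
  P (1 - e *+ 2) = 1 - e' *+ 2 ->
  w \is a GRing.unit -> w * e = e * w -> P w * e' = e' * P w.
Proof.
move=> ee e'e' Pt wu we; have tu := involution_unit ee.
apply: (mulrn2_inj char_not2) => /=.
suff : P w * (1 - e' *+ 2) = (1 - e' *+ 2) * P w.
  by rewrite mulrBr mulrBl mulr1 mul1r mulrnAr mulrnAl => /addrI/oppr_inj.
by rewrite -Pt -!(gi_mul PQ) //; congr P; nc we.
Qed.

Lemma involution_compl (e f : A) (e' f' : B) : frame e f -> frame e' f' ->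
  P (1 - e *+ 2) = 1 - e' *+ 2 -> P (1 - f *+ 2) = 1 - f' *+ 2.
Proof.
move=> fr fr' Pt; rewrite (frame_rE fr) (frame_rE fr').
have -> : 1 - (1 - e) *+ 2 = - (1 - e *+ 2) by nc.
rewrite (giN char_not2 lmB PQ) ?Pt; first by nc.
by rewrite involution_unit // (fr_l fr).
Qed.

End InvolutionImage.

Section Matching.
Variables (A B : unitAlgType F).
Hypotheses (lmA : unital_locally_matrix A) (lmB : unital_locally_matrix B).
Variables (P : A -> B) (Q : B -> A).
Hypothesis PQ : group_iso P Q.

(** Of the four combinations given by [block_dichotomy], the two mixed ones send opposite root
    subgroups into one commutative group. *)
Lemma matched_or_flipped (e f : A) (e' f' : B) : frame e f -> frame e' f' ->
  P (1 - e *+ 2) = 1 - e' *+ 2 ->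
  matched P e f e' f' \/ matched P e f f' e'.
Proof.
move=> fr fr' Pt; have fs := frame_sym fr; have fs' := frame_sym fr'.
have Pt' := involution_compl lmB PQ fr fr' Pt.
have C w : w \is a GRing.unit -> w * e = e * w -> P w * e' = e' * P w.
  exact: (centralizer_image PQ (fr_l fr) (fr_l fr') Pt).
have C' w : w \is a GRing.unit -> w * e = e * w -> P w * f' = f' * P w.
  by move=> wu we; rewrite (frame_rE fr') mulrBr mulrBl mulr1 mul1r C.
have [lr|lr] := block_dichotomy char_not2 char_not3 lmB PQ fr fr' Pt;
have [rl|rl] := block_dichotomy char_not2 char_not3 lmB PQ fs fs' Pt'.
- by left; split.
- by case: (opposite_blocks_noncommuting lmA PQ fr fr' lr rl).
- by case: (opposite_blocks_noncommuting lmA PQ fr fs' lr rl).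
- by right; split.
Qed.

End Matching.

Lemma matched_frame (A B : unitAlgType F) (P : A -> B) (Q : B -> A) (e f : A) :
  unital_locally_matrix A -> unital_locally_matrix B -> group_iso P Q -> frame e f ->
  exists e' f', [/\ frame e' f', matched P e f e' f' & matched Q e' f' e f].
Proof.
move=> lmA lmB PQ fr; have QP := group_iso_sym PQ.
have [||e' [e'e' e'0 e'1 Pt]] := image_idempotent char_not2 lmB PQ (fr_l fr).
- exact: fr_l0 fr.
- by rewrite -subr_eq0 -opprB oppr_eq0 -(frame_rE fr) (fr_r0 fr).
have fr' := frame_compl e'e' e'0 e'1; set f' := 1 - e' in fr'.
have Qt : Q (1 - e' *+ 2) = 1 - e *+ 2.
  by rewrite -Pt (gi_K PQ) // involution_unit // (fr_l fr).
have fs := frame_sym fr; have fs' := frame_sym fr'.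
have [M|M] := matched_or_flipped lmA lmB PQ fr fr' Pt;
have [N|N] := matched_or_flipped lmB lmA QP fr' fr Qt.
- by exists e', f'.
- by case: (block_not_flipped lmA PQ fr (mt_lr M) (mt_lr N)).
- by case: (block_not_flipped lmA PQ fr (mt_lr M) (mt_rl N)).
(* Here [P] and [Q] are both flipped, and exchanging [e'] and [f'] repairs both. *)
exists f', e'; split=> //.
exact: matched_sym fr' fs N.
Qed.

(** * Additive maps on the two blocks *)

Section Blocks.
Variables (A B : unitAlgType F).
Hypotheses (lmA : unital_locally_matrix A) (lmB : unital_locally_matrix B).
Variables (P : A -> B) (Q : B -> A).
Hypothesis PQ : group_iso P Q.

(** Defined on all of [A] to avoid a type for the block; by [block_map_proj] only [e * x * f]
    matters. *)
Definition block_map (e f x : A) : B := P (1 + e * x * f) - 1.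

Section BlockMap.
Variables (e f : A) (e' f' : B).
Hypotheses (fr : frame e f) (fr' : frame e' f').
Hypotheses (M : matched P e f e' f') (N : matched Q e' f' e f).
Notation al := (block_map e f).

Let ee := fr_l fr.
Let ff := fr_r fr.
Let ef := fr_lr fr.
Let fe := fr_rl fr.
Let ee' := fr_l fr'.
Let ff' := fr_r fr'.
Let ef' := fr_lr fr'.
Let fe' := fr_rl fr'.

Lemma block_mapE x : P (1 + e * x * f) = 1 + al x.
Proof. by rewrite /block_map [RHS]addrC subrK. Qed.

Lemma block_map_in x : e' * al x * f' = al x.
Proof.
have [y Py] := mt_lr M x; rewrite /block_map Py.
by nc (ee', ff').
Qed.

Lemma block_map_rules x :
  [/\ e' * al x = al x, al x * f' = al x, f' * al x = 0 & al x * e' = 0].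
Proof. by split; rewrite -(block_map_in x); nc (ee', ff', fe'). Qed.

Lemma block_mapD : {morph al : x y / x + y}.
Proof.
move=> x y; apply: (addrI 1); rewrite -block_mapE.
have -> : 1 + e * (x + y) * f = (1 + e * x * f) * (1 + e * y * f) by nc fe.
rewrite (gi_mul PQ) ?(block_unit _ fr) // !block_mapE.
have [_ xf _ _] := block_map_rules x; have [ey _ _ _] := block_map_rules y.
have xy : al x * al y = 0 by rewrite -xf -ey; nc fe'.
by nc xy.
Qed.

Lemma block_map0 : al 0 = 0.
Proof. by apply: (addrI (al 0)); rewrite -block_mapD !addr0. Qed.

Lemma block_mapN x : al (- x) = - al x.
Proof. by apply: (addrI (al x)); rewrite -block_mapD !subrr block_map0. Qed.

Lemma block_mapMn x n : al (x *+ n) = al x *+ n.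
Proof. by elim: n => [|n IH]; rewrite ?mulr0n ?block_map0 // !mulrS block_mapD IH. Qed.

Lemma block_map_proj x y : e * x * f = e * y * f -> al x = al y.
Proof. by rewrite /block_map => ->. Qed.

Lemma block_map_surj y : exists x, al x = e' * y * f'.
Proof.
have [x Qx] := mt_lr N y; exists x; rewrite /block_map -Qx (gi_VK PQ) ?(block_unit _ fr') //.
by rewrite addrC addKr.
Qed.

End BlockMap.

Section BlockPair.
Variables (e f : A) (e' f' : B).
Hypotheses (fr : frame e f) (fr' : frame e' f').
Hypotheses (M : matched P e f e' f') (N : matched Q e' f' e f).
Notation al := (block_map e f).
Notation be := (block_map f e).

Let ee := fr_l fr.
Let ff := fr_r fr.
Let ef := fr_lr fr.
Let fe := fr_rl fr.
Let ee' := fr_l fr'.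
Let ff' := fr_r fr'.
Let ef' := fr_lr fr'.
Let fe' := fr_rl fr'.
Let fs := frame_sym fr.
Let fs' := frame_sym fr'.
Let MS := matched_sym fr fr' M.
Let NS := matched_sym fr' fr N.
Let alD := block_mapD fr fr' M.
Let beD := block_mapD fs fs' MS.
Let alR := block_map_rules fr' M.
Let beR := block_map_rules fs' MS.

(* The LDU factorisation [(1 + x)(1 + y) = (1 + y k) D (1 + k x)]. *)
Lemma block_map_quasi_inverse x y k :
  e * x * f = x -> f * y * e = y -> e * k * e = k ->
  k * (e + x * y) = e -> (e + x * y) * k = e ->
  al x = (e' + al x * be y) * al (k * x).
Proof.
move=> xE yE kE kl kr.
have ex : e * x = x by rewrite -xE; nc ee.
have xf : x * f = x by rewrite -xE; nc ff.
have fy : f * y = y by rewrite -yE; nc ff.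
have ye : y * e = y by rewrite -yE; nc ee.
have ek : e * k = k by rewrite -kE; nc ee.
have ke : k * e = k by rewrite -kE; nc ee.
have fk : f * k = 0 by rewrite -ek; nc fe.
have fx : f * x = 0 by rewrite -ex; nc fe.
have xe : x * e = 0 by rewrite -xf; nc fe.
have ey : e * y = 0 by rewrite -fy; nc ef.
have yf : y * f = 0 by rewrite -ye; nc ef.
have kf : k * f = 0 by rewrite -ke; nc ef.
have ky : k * y = 0 by rewrite -ke; nc ey.
have xk : x * k = 0 by rewrite -ek; nc xe.
have xx : x * x = 0 by rewrite -{2}ex; nc xe.
have yy : y * y = 0 by rewrite -{2}fy; nc yf.
have kxy : k * x * y = e - k by rewrite -kl mulrDr ke mulrA; nc.
have xyk : x * y * k = e - k by rewrite -kr mulrDl ek; nc.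
have e1 : 1 = e + f := esym (fr_1 fr).
have ux : 1 + x \is a GRing.unit by rewrite -xE (block_unit _ fr).
have uy : 1 + y \is a GRing.unit by rewrite -yE (block_unit _ (frame_sym fr)).
have ykE : y * k = f * (y * k) * e by nc (fy, ke).
have kxE : k * x = e * (k * x) * f by nc (ek, xf).
have uyk : 1 + y * k \is a GRing.unit by rewrite ykE (block_unit _ (frame_sym fr)).
have ukx : 1 + k * x \is a GRing.unit by rewrite kxE (block_unit _ fr).
have uyk' : 1 - y * k \is a GRing.unit.
  have -> : 1 - y * k = 1 + f * (- (y * k)) * e by nc (fy, ke).
  by rewrite (block_unit _ (frame_sym fr)).
have ukx' : 1 - k * x \is a GRing.unit.
  have -> : 1 - k * x = 1 + e * (- (k * x)) * f by nc (ek, xf).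
  by rewrite (block_unit _ fr).
have [D [uD De LDU]] : exists D, [/\ D \is a GRing.unit, D * e = e * D
    & (1 + x) * (1 + y) = (1 + y * k) * D * (1 + k * x)].
  (* [D] is block diagonal, with corners [e + x y] and [f - y k x]. *)
  pose D := (1 - y * k) * ((1 + x) * (1 + y)) * (1 - k * x).
  have DE : D = e + x * y + f - y * k * x.
    by rewrite /D e1; nc (ee, ff, ef, fe, ex, xf, fy, ye, ek, ke, fk, fx, xe, ey, yf, kf,
      kxy, xyk, ky, xk, xx, yy).
  exists D; split; first by rewrite !rpredM.
    by rewrite DE; nc (ee, ff, ef, fe, ex, xf, fy, ye, ek, ke, fk, fx, xe, ey, yf, kf,
      kxy, xyk, ky, xk, xx, yy).
  rewrite DE [in LHS]e1 [in RHS]e1.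
  by nc (ee, ff, ef, fe, ex, xf, fy, ye, ek, ke, fk, fx, xe, ey, yf, kf,
      kxy, xyk, ky, xk, xx, yy).
have {LDU} := congr1 P LDU; rewrite !(gi_mul PQ) ?rpredM // -{1}xE -{1}yE.
have -> : P (1 + y * k) = 1 + be (y * k) by rewrite -block_mapE -ykE.
have -> : P (1 + k * x) = 1 + al (k * x) by rewrite -block_mapE -kxE.
have := mt_C M uD De; move: (P D) => D' De'; rewrite !block_mapE => H.
have [ax xa fax axe] := alR x; have [by_ yb eby byf] := beR y.
have [az za faz aze] := alR (k * x); have [bv vb ebv bvf] := beR (y * k).
(* The [e']-corners determine that of [D']; comparing the blocks in [e' B f'] then gives the
   claim. *)
have h1 : e' + al x * be y = e' * D'.
  transitivity (e' * ((1 + be (y * k)) * D' * (1 + al (k * x))) * e').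
    rewrite -H; nc (ee', ax, xa, fax, axe, by_, yb, eby, byf).
  by nc (ee', De', aze, ebv).
transitivity (e' * ((1 + be (y * k)) * D' * (1 + al (k * x))) * f').
  by rewrite -H; nc (ee', ef', ax, xa, fax, axe, by_, yb, eby, byf).
by rewrite h1; nc (ee', ef', esym De', za, az, ebv).
Qed.

(* Apply the quasi-inverse identity to [y] and [- y]. *)
Lemma block_map_jordan_nilpotent x y : e * x * f = x -> f * y * e = y ->
  y * x * y = 0 -> al (x * y * x) = al x * be y * al x.
Proof.
move=> xE yE yxy; have [ax _ _ _] := alR x.
have ex : e * x = x by rewrite -xE; nc ee.
have ye : y * e = y by rewrite -yE; nc ee.
have xyN s : s = y \/ s = - y -> al x = (e' + al x * be s) * al (x - x * s * x).
  move=> sy; have sxs : s * x * s = 0 by case: sy => ->; [|rewrite mulrN !mulNr yxy !oppr0].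
  have se : s * e = s by case: sy => ->; nc ye.
  (* Since [s x s = 0], the inverse of [e + x s] in the corner is [e - x s]. *)
  have -> : x - x * s * x = (e - x * s) * x by nc ex.
  apply: block_map_quasi_inverse; rewrite ?xE //.
  - by case: sy => -> //; rewrite mulrN mulNr yE.
  - by nc (ee, ex, se).
  - by nc (ee, ex, se, sxs).
  - by nc (ee, ex, se, sxs).
have := xyN y (or_introl erefl); have := xyN (- y) (or_intror erefl).
rewrite (block_mapN fs fs' MS) !mulrN !mulNr opprK !alD (block_mapN fr fr' M).
have [aw _ _ _] := alR (x * y * x).
set X := al x in ax *; set Y := be y; set W := al _ in aw * => h1 h2.
apply: subr0_eq; apply: (mulrn2_inj char_not2); rewrite /= mul0rn.
transitivity ((e' - X * Y) * (X + W) - (e' + X * Y) * (X - W)).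
  by nc (ax, aw).
by rewrite -h1 -h2 subrr.
Qed.

(* Apply the quasi-inverse identity to [y] and [- 2 y]. *)
Lemma block_map_jordan_idempotent x y : e * x * f = x -> f * y * e = y ->
  y * x * y = y -> al (x * y * x) = al x * be y * al x.
Proof.
move=> xE yE yxy; have [ax _ _ _] := alR x.
have ex : e * x = x by rewrite -xE; nc ee.
have ye : y * e = y by rewrite -yE; nc ee.
have [aw _ _ _] := alR (x * y * x).
set X := al x in ax *; set Y := be y; set W := al (x * y * x) in aw *.
(* As [x y] is idempotent, [e - 2 x y] is its own inverse in the corner. *)
have h2 : X = (e' - X * Y *+ 2) * (X - W *+ 2).
  have -> : X * Y *+ 2 = - (X * be (- y *+ 2)).
    by rewrite (block_mapMn fs fs' MS) (block_mapN fs fs' MS) -/Y; nc.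
  have -> : X - W *+ 2 = al ((e - x * y *+ 2) * x).
    have -> : (e - x * y *+ 2) * x = x + - (x * y * x) *+ 2 by nc ex.
    by rewrite alD (block_mapMn fr fr' M) (block_mapN fr fr' M) -/W -/X; nc.
  rewrite opprK; apply: block_map_quasi_inverse => //.
  - by rewrite -[in RHS]yE; nc.
  - by nc (ee, ex, ye).
  - by nc (ee, ex, ye, yxy).
  - by nc (ee, ex, ye, yxy).
(* The inverse of [e + x y] is [e - q], with [q] half of the idempotent [x y]. *)
pose q := 2%:R^-1 *: (x * y); have q2 : q *+ 2 = x * y := scale_half_double char_not2 _.
have qxy : q * x * y = q by rewrite /q -!scalerAl; congr (_ *: _); nc yxy.
have xyq : x * y * q = q by rewrite /q -!scalerAr; congr (_ *: _); nc yxy.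
have eq_ : e * q = q by rewrite /q -scalerAr; congr (_ *: _); nc ex.
have qe : q * e = q by rewrite /q -scalerAl; congr (_ *: _); nc ye.
have h1 : X = (e' + X * Y) * (X - al (q * x)).
  rewrite -(block_mapN fr fr' M) -alD.
  have -> : x + - (q * x) = (e - q) * x by nc ex.
  apply: block_map_quasi_inverse => //.
  - by nc (ee, eq_, qe).
  - by nc (ee, ex, ye, qxy, qe, esym q2).
  - by nc (ee, ex, ye, xyq, eq_, qe, esym q2).
have qW : al (q * x) *+ 2 = W.
  by rewrite -(block_mapMn fr fr' M) -mulrnAl q2.
have [aq _ _ _] := alR (q * x).
apply: subr0_eq; apply: (mulrn3_inj char_not3); apply: (mulrn2_inj char_not2).
rewrite /= !mul0rn.
have qW' : W = al (q * x) *+ 2 by rewrite qW.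
(* The coefficient 8 eliminates [X Y W] and leaves [6 (W - X Y X)], which is divisible by 6 thanks
   to both characteristic assumptions. *)
transitivity (((e' + X * Y) * (X - al (q * x)) - X) *+ 8 * (-1)
  + (X - (e' - X * Y *+ 2) * (X - W *+ 2))).
  by rewrite qW'; nc (ax, aq).
by rewrite -h1 -h2; nc.
Qed.

End BlockPair.
End Blocks.
End MatchedFrames.

(** * Jordan and associative triple products *)

(** If [x] lies outside [S] and [y] in [S], then [x] and [x + y] both lie in [T], hence so does
    [y]. *)
Lemma additive_union (V : zmodType) (S T : V -> Prop) :
  (forall x y, S x -> S y -> S (x - y)) -> (forall x y, T x -> T y -> T (x - y)) ->
  (forall x, S x \/ T x) -> (forall x, S x) \/ (forall x, T x).
Proof.
move=> SB TB ST; case: (pselect (forall x, S x)) => [|/existsNP[x nSx]]; first by left.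
right=> y; have [Sy|//] := ST y.
have Tx : T x by case: (ST x).
have [Sxy|Txy] := ST (x + y).
  by case: nSx; rewrite -(addrK y x); exact: SB.
by rewrite -(addKr x y) addrC -{1}[x]opprK opprK; apply: TB; rewrite // addrC.
Qed.

Section Dichotomy.
Variables (F : fieldType).
Hypotheses (char_not2 : 2%N \notin [pchar F]) (char_not3 : 3%N \notin [pchar F]).
Variables (A B : unitAlgType F).
Hypotheses (lmA : unital_locally_matrix A) (lmB : unital_locally_matrix B).

(* Herstein's trick: [(p b q) c (p b q)] equals its own opposite. *)
Lemma prime_symmetric_sandwich (p q : B) :
  (forall b, p * b * q + q * b * p = 0) -> p = 0 \/ q = 0.
Proof.
move=> pq; have sw b : p * b * q = - (q * b * p) by apply/eqP; rewrite -addr_eq0 pq.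
apply: (prime_alg lmB) => b.
suff /(prime_alg lmB)[] : forall c, p * b * q * c * (p * b * q) = 0 by [].
move=> c; apply: (mulrn2_inj char_not2); rewrite /= mul0rn.
have s1 : p * b * q * c * (p * b * q) = p * (b * p * c) * q * b * q.
  transitivity (- (q * (b * p * c) * p) * b * q
    + (p * b * q + q * b * p) * c * p * b * q); first by nc.
  by rewrite pq -sw; nc.
have s2 : p * (b * p * c) * q * b * q = p * b * (p * c * q) * b * q by nc.
have s3 : p * b * (p * c * q) * b * q = - (p * b * q * c * (p * b * q)) by rewrite sw; nc.
by rewrite mulr2n {1}s1 s2 s3 addNr.
Qed.

Variables (P : A -> B) (Q : B -> A).
Hypothesis PQ : group_iso P Q.
Variables (e f : A) (e' f' : B).
Hypotheses (fr : frame e f) (fr' : frame e' f').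
Hypotheses (M : matched P e f e' f') (N : matched Q e' f' e f).
Notation al := (block_map P e f).
Notation be := (block_map P f e).

Let ee := fr_l fr.
Let ff := fr_r fr.
Let ef := fr_lr fr.
Let fe := fr_rl fr.
Let ee' := fr_l fr'.
Let ff' := fr_r fr'.
Let ef' := fr_lr fr'.
Let fe' := fr_rl fr'.
Let fs := frame_sym fr.
Let fs' := frame_sym fr'.
Let MS := matched_sym fr fr' M.
Let NS := matched_sym fr' fr N.
Let alD := block_mapD PQ fr fr' M.
Let beD := block_mapD PQ fs fs' MS.
Let alR := block_map_rules fr' M.
Let beR := block_map_rules fs' MS.

(* [c e + f] is central in the centraliser of [e], so its image is scalar on both
   corners and acts on the two blocks by one and the same factor [s]. *)
Lemma block_map_scale (c : F) : c != 0 ->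
  exists s : F, forall x, al (c *: x) = s *: al x /\ be (c *: x) = s *: be x.
Proof.
move=> c0; pose d := c *: e + f.
have cA (z : A) : c *: z = c%:A * z by rewrite -scalerAl mul1r.
have cC (z : A) : z * c%:A = c%:A * z by rewrite -scalerAr -scalerAl mulr1 mul1r.
have dx x : d * (e * x * f) = (e * (c *: x) * f) * d.
  by rewrite /d (cA e) (cA x); nc (ee, ff, ef, fe, cC e, cC f, cC x).
(* On this block conjugation by [d] acts by [c^-1], so [c] sits on the other side; both computations
   then yield the same factor [a / b]. *)
have dy y : d * (f * (c *: y) * e) = f * y * e * d.
  by rewrite /d (cA e) (cA y); nc (ee, ff, ef, fe, cC e, cC f, cC y).
have dV a b : a * b = 1 -> (a *: e + f) * (b *: e + f) = 1.
  move=> ab; rewrite mulrDl !mulrDr -!scalerAl -!scalerAr scalerA ab scale1r ee ef fe ff.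
  by rewrite !scaler0 add0r addr0 (fr_1 fr).
have du : d \is a GRing.unit.
  by apply: (@unitrI _ _ _ (c^-1 *: e + f)); apply: dV; rewrite ?mulVf ?mulfV.
have de : d * e = e * d.
  by rewrite /d mulrDl mulrDr -scalerAl -scalerAr ef fe.
have dw w : w * e = e * w -> d * w = w * d.
  move=> we; rewrite /d mulrDl mulrDr -scalerAl -scalerAr we; congr (_ + _).
  by rewrite (frame_rE fr) mulrBl mulrBr we mul1r mulr1.
have De := mt_C M du de; set D := P d in De.
have Df : D * f' = f' * D by rewrite (frame_rE fr') mulrBl mulrBr De mul1r mulr1.
have DC W : W \is a GRing.unit -> W * e' = e' * W -> D * W = W * D.
  move=> Wu We; have we := mt_C N Wu We.
  by rewrite -[W](gi_VK PQ) // -!(gi_mul PQ) ?(gi_unitV PQ) // dw.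
have [||W Wu We|a Da] := @corner_center _ _ char_not2 lmB e' (e' * D) ee' (fr_l0 fr').
- by rewrite mulrA ee'.
- by nc (De, ee').
- by rewrite mulrA We -!mulrA DC.
have [||W Wu Wf|b Db] := @corner_center _ _ char_not2 lmB f' (f' * D) ff' (fr_r0 fr').
- by rewrite mulrA ff'.
- by nc (Df, ff').
- have We : W * e' = e' * W.
    by rewrite (frame_rE fs') mulrBl mulrBr mul1r mulr1 Wf.
  by rewrite mulrA Wf -!mulrA DC.
have Du : D \is a GRing.unit := gi_unit PQ du.
have b0 : b != 0.
  apply: contraNneq (fr_r0 fr') => b0; apply/eqP/(mulIr Du).
  by rewrite Db b0 scale0r mul0r.
exists (a / b) => x; split.
- have : D * P (1 + e * x * f) = P (1 + e * (c *: x) * f) * D.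
    rewrite -!(gi_mul PQ) ?(block_unit _ fr) //; congr P.
    by nc (dx x).
  rewrite !block_mapE mulrDr mulrDl mulr1 mul1r => /addrI h.
  have [ax _ _ _] := alR x; have [_ xf _ _] := alR (c *: x).
  apply: (scalerI b0); rewrite scalerA mulrCA divff // mulr1.
  rewrite -{1}xf scalerAr -Db -Df mulrA -h -mulrA.
  have [_ xf' _ _] := alR x; rewrite xf' -{1}ax mulrA De Da.
  by rewrite -scalerAl ax.
have : P (1 + f * x * e) * D = D * P (1 + f * (c *: x) * e).
  rewrite -!(gi_mul PQ) ?(block_unit _ fs) //; congr P.
  by nc (dy x).
rewrite !block_mapE mulrDr mulrDl mulr1 mul1r => /addrI h.
have [ax _ _ _] := beR (c *: x); have [ax' xf _ _] := beR x.
apply: (scalerI b0); rewrite scalerA mulrCA divff // mulr1.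
rewrite -{1}ax scalerAl -Db -Df -mulrA ax -h.
by rewrite -{1}xf -mulrA Da -scalerAr xf.
Qed.

(** Both sides are additive in [y], which is split into [r] with [r x0 r = c r]. For [c = 0] the
    nilpotent case applies; otherwise [y0 / c] falls under the idempotent case, and
    [block_map_scale] takes the same factor out of both sides. *)
Lemma block_map_jordan x y :
  al (x * f * y * e * x) = al x * be y * al x.
Proof.
set x0 := e * x * f.
have alx : al x = al x0 by apply: block_map_proj; rewrite /x0; nc (ee, ff).
have x0E : e * x0 * f = x0 by rewrite /x0; nc (ee, ff).
have [rs [-> rsP]] := rank_one_sum lmA y [:: x0].
elim: rs rsP => [|r rs IH] rsP.
  rewrite big_nil mulr0 !mul0r (block_map0 PQ fr fr' M) (block_map0 PQ fs fs' MS).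
  by rewrite mulr0 mul0r.
rewrite big_cons beD.
have -> : x * f * (r + \sum_(j <- rs) j) * e * x =
  x * f * r * e * x + x * f * (\sum_(j <- rs) j) * e * x by nc.
rewrite alD IH; last by move=> s z srs; apply: rsP; rewrite in_cons srs orbT.
have dist (u v w : B) : u * (v + w) * u = u * v * u + u * w * u by nc.
rewrite dist; congr (_ + _).
have [c rxr] := rsP r x0 (mem_head _ _) (mem_head _ _).
set y0 := f * r * e.
have bey : be r = be y0 by apply: block_map_proj; rewrite /y0; nc (ee, ff).
have y0E : f * y0 * e = y0 by rewrite /y0; nc (ee, ff).
have yxy : y0 * x0 * y0 = c *: y0.
  have -> : y0 * x0 * y0 = f * (r * x0 * r) * e by rewrite /y0 /x0; nc (ee, ff).
  by rewrite rxr -scalerAr -scalerAl.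
have -> : al (x * f * r * e * x) = al (x0 * y0 * x0).
  by apply: block_map_proj; rewrite /x0 /y0; nc (ee, ff).
rewrite alx bey; case: (eqVneq c 0) => [c0|c0].
  by apply: (block_map_jordan_nilpotent char_not2 PQ fr fr' M); rewrite // yxy c0 scale0r.
have [s sP] := block_map_scale c0.
have [y1 [y0y1 y1E yxy1]] : exists y1, [/\ y0 = c *: y1, f * y1 * e = y1 & y1 * x0 * y1 = y1].
  exists (c^-1 *: y0); split; first by rewrite scalerA divff // scale1r.
    by rewrite -scalerAr -scalerAl y0E.
  rewrite -!scalerAl -!scalerAr yxy !scalerA.
  by congr (_ *: _); field; rewrite c0.
have -> : x0 * y0 * x0 = c *: (x0 * y1 * x0) by rewrite y0y1 -scalerAr -scalerAl.
rewrite (sP _).1 y0y1 (sP _).2.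
rewrite (block_map_jordan_idempotent char_not2 char_not3 PQ fr fr' M) //.
by rewrite -scalerAr -scalerAl.
Qed.

End Dichotomy.

Section TripleProducts.
Variables (F : fieldType).
Hypotheses (char_not2 : 2%N \notin [pchar F]) (char_not3 : 3%N \notin [pchar F]).
Variables (A B : unitAlgType F).
Hypotheses (lmA : unital_locally_matrix A) (lmB : unital_locally_matrix B).
Variables (P : A -> B) (Q : B -> A).
Hypothesis PQ : group_iso P Q.
Variables (e f : A) (e' f' : B).
Hypotheses (fr : frame e f) (fr' : frame e' f').
Hypotheses (M : matched P e f e' f') (N : matched Q e' f' e f).
Notation al := (block_map P e f).
Notation be := (block_map P f e).

Let fs := frame_sym fr.
Let fs' := frame_sym fr'.
Let MS := matched_sym fr fr' M.
Let NS := matched_sym fr' fr N.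
Let alD := block_mapD PQ fr fr' M.
Let beD := block_mapD PQ fs fs' MS.
Let alN := block_mapN PQ fr fr' M.
Let beN := block_mapN PQ fs fs' MS.
Let al_jordan := block_map_jordan char_not2 char_not3 lmA lmB PQ fr fr' M N.
Let be_jordan := block_map_jordan char_not2 char_not3 lmA lmB PQ fs fs' MS NS.

(** Polarisation of [block_map_jordan] at [x + z]. *)
Lemma block_map_jordan_linear x y z :
  al (x * f * y * e * z + z * f * y * e * x) =
  al x * be y * al z + al z * be y * al x.
Proof.
have -> : x * f * y * e * z + z * f * y * e * x =
  (x + z) * f * y * e * (x + z) + (- (x * f * y * e * x) + - (z * f * y * e * z)) by nc.
by rewrite !alD !alN !al_jordan !alD; nc.
Qed.

(** [al p] and [al p'] have the same sum as [D1] and [D2], and the same symmetrised product through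
    every [be w]. Hence [al p - D1] and [al p - D2] satisfy the hypothesis of
    [prime_symmetric_sandwich]. *)
Lemma block_map_triple_or x y z :
  al (x * f * y * e * z) = al x * be y * al z \/
  al (x * f * y * e * z) = al z * be y * al x.
Proof.
set p := x * f * y * e * z; set p' := z * f * y * e * x.
set D1 := al x * be y * al z; set D2 := al z * be y * al x.
have pp' : al p' = D1 + D2 - al p.
  by rewrite -(block_map_jordan_linear x y z) -/p -/p' alD; nc.
have inside u : al u = e' * al u * f' by rewrite (block_map_in fr' M).
have D1in : D1 = e' * D1 * f' by rewrite /D1 (inside x) (inside z); nc (fr_l fr', fr_r fr').
have D2in : D2 = e' * D2 * f' by rewrite /D2 (inside x) (inside z); nc (fr_l fr', fr_r fr').
suff /(prime_symmetric_sandwich char_not2 lmB) [/subr0_eq|/subr0_eq] :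
    forall b, (al p - D1) * b * (al p - D2) + (al p - D2) * b * (al p - D1) = 0.
- by left.
- by right.
move=> b; have [w bw] := block_map_surj PQ fs' NS b.
transitivity ((al p - D1) * (f' * b * e') * (al p - D2)
  + (al p - D2) * (f' * b * e') * (al p - D1)).
  by rewrite (inside p) D1in D2in; nc (fr_l fr', fr_r fr').
rewrite -bw.
(* [p w p' + p' w p = x (y (z w z) y) x + z (y (x w x) y) z] *)
have h1 := block_map_jordan_linear p w p'.
have h2 : al (p * f * w * e * p' + p' * f * w * e * p) = D1 * be w * D2 + D2 * be w * D1.
  have -> : p * f * w * e * p' + p' * f * w * e * p =
      x * f * (y * e * (z * f * w * e * z) * f * y) * e * x
    + z * f * (y * e * (x * f * w * e * x) * f * y) * e * z by rewrite /p /p'; nc.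
  rewrite alD (al_jordan x) (al_jordan z) !be_jordan !al_jordan.
  by rewrite /D1 /D2; nc.
transitivity (D1 * be w * D2 + D2 * be w * D1 - (al p * be w * al p' + al p' * be w * al p)).
  by rewrite pp'; nc.
by rewrite -h1 -h2 subrr.
Qed.

(** [additive_union] makes the choice uniform in [z], then in [y], then in [x]. *)
Lemma block_map_triple_dichotomy :
  (forall x y z, al (x * f * y * e * z) = al x * be y * al z) \/
  (forall x y z, al (x * f * y * e * z) = al z * be y * al x).
Proof.
have alB u v : al (u - v) = al u - al v by rewrite alD alN.
have beB u v : be (u - v) = be u - be v by rewrite beD beN.
have Bx x1 x2 y z : (x1 - x2) * f * y * e * z = x1 * f * y * e * z - x2 * f * y * e * z by nc.
have By x y1 y2 z : x * f * (y1 - y2) * e * z = x * f * y1 * e * z - x * f * y2 * e * z by nc.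
have Bz x y z1 z2 : x * f * y * e * (z1 - z2) = x * f * y * e * z1 - x * f * y * e * z2 by nc.
apply: additive_union => [x1 x2 h1 h2 y z|x1 x2 h1 h2 y z|x].
- by rewrite Bx !alB h1 h2; nc.
- by rewrite Bx !alB h1 h2; nc.
apply: additive_union => [y1 y2 h1 h2 z|y1 y2 h1 h2 z|y].
- by rewrite By alB beB h1 h2; nc.
- by rewrite By alB beB h1 h2; nc.
apply: additive_union => [z1 z2 h1 h2|z1 z2 h1 h2|z].
- by rewrite Bz !alB h1 h2; nc.
- by rewrite Bz !alB h1 h2; nc.
exact: block_map_triple_or.
Qed.

End TripleProducts.

(** * Extension to a ring isomorphism *)

Section StableRange.
Variables (F : fieldType) (A : unitAlgType F).
Hypothesis lmA : unital_locally_matrix A.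
Variables (e f : A).
Hypothesis fr : frame e f.

(* Writing [e g e = p u] with [u] a unit of the corner, right multiplication by
   [1 + f g^-1 (e - p) u e] makes the [e]-corner of [g] invertible. *)
Lemma unit_LDUL (g : A) : g \is a GRing.unit ->
  exists c b y D : A, [/\ D \is a GRing.unit, D * e = e * D
    & g = (1 + f * c * e) * D * (1 + e * b * f) * (1 + f * y * e)].
Proof.
move=> gu; have [ee ff ef fe ef1 _ _] := fr; have e1 := esym ef1.
have [|p [u [v [pp epe eue eve [uv vu pu]]]]] := unit_regular_corner lmA (a := e * g * e) ee.
  by nc ee.
have ep : e * p = p by rewrite -epe; nc ee.
have pe : p * e = p by rewrite -epe; nc ee.
have eu : e * u = u by rewrite -eue; nc ee.
have ue : u * e = u by rewrite -eue; nc ee.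
have ev : e * v = v by rewrite -eve; nc ee.
have ve : v * e = v by rewrite -eve; nc ee.
pose g' := g^-1; have gg' : g * g' = 1 by rewrite /g' mulrV.
pose q := e - p; pose w := e * g * f * g' * e.
have qp : q * p = 0 by rewrite /q; nc (pp, ep).
have pq : p * q = 0 by rewrite /q; nc (pp, pe).
have qq : q * q = q by rewrite /q; nc (pp, pe, ep, ee).
have qe : q * e = q by rewrite /q; nc (pe, ee).
have eq_ : e * q = q by rewrite /q; nc (ep, ee).
have ew : e * w = w by rewrite /w; nc ee.
have we : w * e = w by rewrite /w; nc ee.
(* Split [g g^-1 = 1] through [e + f]: the [e] part dies under [q], because [e g e = p u] and
   [q p = 0]. *)
have qw : q * w = q.
  transitivity (q * (e * (g * (e + f) * g') * e) - q * (e * g * e) * g' * e).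
    by rewrite /w; nc ee.
  rewrite ef1 mulr1 gg' pu; transitivity (q * e * e - (q * p) * u * g' * e); first by nc.
  by rewrite qp; nc qe.
pose y := g' * q * u; pose h := g * (1 + f * y * e).
pose k := e * h * e; pose k' := v * (e - p * w * q).
have kE : k = (e + p * w * q) * u.
  transitivity (e * g * e + e * g * f * g' * e * q * u).
    by rewrite /k /h /y; nc (ee, eq_, ue).
  rewrite -/w pu; transitivity (p * u + (p + q) * w * q * u).
    by rewrite /q; nc (ew, ee).
  transitivity (p * u + p * w * q * u + q * w * q * u); first by nc.
  by rewrite qw qq /q; nc eu.
(* Thus [e + p w q] has inverse [e - p w q] in the corner, so [k] is invertible there with inverse
   [k']. *)
have pwq2 : (p * w * q) * (p * w * q) = 0 by nc qp.
have kk' : k * k' = e.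
  by rewrite kE /k'; nc (uv, ee, ep, qe, eu, ue, pwq2).
have k'k : k' * k = e.
  by rewrite kE /k'; nc (vu, ee, ep, qe, eu, ue, ve, ev, pwq2).
have ek' : e * k' = k' by rewrite /k'; nc ev.
have k'e : k' * e = k' by rewrite /k'; nc (ee, qe).
have uL c : 1 + f * c * e \is a GRing.unit := block_unit c (frame_sym fr).
have uU c : 1 + e * c * f \is a GRing.unit := block_unit c fr.
have hu : h \is a GRing.unit by rewrite rpredM.
have ekk : e * h * e * k' = e by [].
have k'ek : k' * h * e = e by rewrite -[in RHS]k'k /k; nc k'e.
have ehk' : e * h * k' = e by rewrite -[in RHS]kk' /k; nc ek'.
(* Once the corner is invertible, one row and one column operation clear both off-diagonal blocks of
   [h]. *)
pose D := (1 + f * (- (h * k')) * e) * h * (1 + e * (- (k' * h)) * f).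
have fD : e * D * f = 0 /\ f * D * e = 0.
  split; rewrite /D.
    by nc (ee, ff, ef, fe, ek', k'e, ehk', k'ek, ekk).
  by nc (ee, ff, ef, fe, ek', k'e, ehk', k'ek, ekk).
exists (h * k'), (k' * h), (- y), D; split.
- by rewrite !rpredM.
- have [eDf fDe] := fD.
  transitivity ((e + f) * D * e); first by rewrite ef1 mul1r.
  transitivity (e * D * (e + f)); last by rewrite ef1 mulr1.
  by nc (eDf, fDe).
have LhU c b : (1 + f * c * e) * ((1 + f * (- c) * e) * h * (1 + e * (- b) * f))
    * (1 + e * b * f) = h.
  by move: h {hu k kE kk' k'k ek' k'e ekk k'ek ehk' D fD k'} => h; nc (ef, fe).
transitivity (h * (1 + f * (- y) * e)); first by rewrite /h; nc ef.
by congr (_ * _); rewrite /D LhU.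
Qed.

End StableRange.

Section DualTriple.
Variables (A S : unitRingType).
Hypothesis primeS : forall a b : S, (forall x, a * x * b = 0) -> a = 0 \/ b = 0.
Variables (e f : A) (e' f' : S) (al be : A -> S).
Hypothesis fr' : frame e' f'.
Hypothesis be_in : forall x, f' * be x * e' = be x.
Hypothesis al_surj : forall b, exists x, al x = e' * b * f'.
Hypothesis al_triple : forall x y z, al (x * f * y * e * z) = al x * be y * al z.

(** The difference [d] of the two sides satisfies [al u * d * al v = 0] by [al_triple]; as [al]
    fills its block, primeness gives [d = 0]. *)
Lemma dual_triple x y z : be (x * e * y * f * z) = be x * al y * be z.
Proof.
have [ee' ff' _ _ _ e0' f0'] := fr'.
apply: subr0_eq; set d := _ - _.
have dE : f' * d * e' = d.
  by rewrite /d -(be_in x) -(be_in z) -(be_in (x * e * y * f * z)); nc (ee', ff').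
have udv u v : al u * d * al v = 0.
  transitivity (al u * be (x * e * y * f * z) * al v - al u * be x * al y * be z * al v).
    by rewrite /d; nc.
  rewrite -!al_triple; apply/eqP; rewrite subr_eq0; apply/eqP; congr al.
  by nc.
have bd b : e' * b * f' * d * e' = 0.
  case: (primeS (a := e' * b * f' * d * e') (b := f')) => // [c|f'0].
    have [u uE] := al_surj b; have [v vE] := al_surj c.
    by rewrite -(udv u v) uE vE; nc.
  by rewrite f'0 eqxx in f0'.
case: (primeS (a := e') (b := d)) => // [b|e'0]; last by rewrite e'0 eqxx in e0'.
by rewrite -dE -(bd b); nc.
Qed.

End DualTriple.

Section CornerExtension.
Variables (A S : unitRingType).
Hypothesis primeS : forall a b : S, (forall x, a * x * b = 0) -> a = 0 \/ b = 0.
Variables (e f : A) (e' f' : S) (al be : A -> S).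
Hypotheses (fr : frame e f) (fr' : frame e' f').
Hypotheses (al_proj : forall x y, e * x * f = e * y * f -> al x = al y)
           (be_proj : forall x y, f * x * e = f * y * e -> be x = be y).
Hypotheses (alD : {morph al : x y / x + y}) (beD : {morph be : x y / x + y}).
Hypotheses (al_in : forall x, e' * al x * f' = al x)
           (be_in : forall x, f' * be x * e' = be x).
Hypotheses (al_surj : forall b, exists x, al x = e' * b * f').
Hypotheses (al_triple : forall x y z, al (x * f * y * e * z) = al x * be y * al z)
           (be_triple : forall x y z, be (x * e * y * f * z) = be x * al y * be z).
Variable s : seq (A * A).
Hypothesis sE : \sum_(p <- s) e * p.1 * f * p.2 * e = e.

(** The value forced on a ring extension of [al] and [be]: by [sE], [e a e] is the sum of the
    products of [e a e p.1 f] and [f p.2 e]. *)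
Definition corner_ext (a : A) : S := \sum_(p <- s) al (a * e * p.1) * be p.2.

Let ee := fr_l fr.
Let ee' := fr_l fr'.

Let al0 : al 0 = 0.
Proof. by apply: (addrI (al 0)); rewrite -alD !addr0. Qed.

Let be0 : be 0 = 0.
Proof. by apply: (addrI (be 0)); rewrite -beD !addr0. Qed.

Lemma corner_extD : {morph corner_ext : a b / a + b}.
Proof.
move=> a b; rewrite /corner_ext -big_split; apply: eq_bigr => p _ /=.
by rewrite !mulrDl alD mulrDl.
Qed.

Lemma corner_ext_in a : e' * corner_ext a * e' = corner_ext a.
Proof.
rewrite /corner_ext mulr_sumr mulr_suml; apply: eq_bigr => p _.
by rewrite -(al_in (a * e * p.1)) -(be_in p.2); nc (ee', fr_r fr').
Qed.

Lemma corner_ext_al a x : corner_ext a * al x = al (a * e * x).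
Proof.
rewrite mulr_suml.
transitivity (\sum_(p <- s) al (a * (e * p.1 * f * p.2 * e) * x)).
  by apply: eq_bigr => p _; rewrite -al_triple; congr al; nc.
by rewrite -(big_morph al alD al0) -mulr_suml -mulr_sumr sE.
Qed.

Lemma be_corner_ext a y : be y * corner_ext a = be (y * e * a).
Proof.
rewrite mulr_sumr.
transitivity (\sum_(p <- s) be (y * e * a * (e * p.1 * f * p.2 * e))).
  apply: eq_bigr => p _; rewrite mulrA -be_triple; apply: be_proj.
  by nc ee.
rewrite -(big_morph be beD be0) -mulr_sumr sE; apply: be_proj; nc ee.
Qed.

(** The difference with [e'] annihilates every [al x], that is, the whole block, so it vanishes by
    primeness. *)
Lemma corner_ext1 : corner_ext 1 = e'.
Proof.
apply: subr0_eq; set d := _ - _.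
have de : d * e' = d by rewrite /d -(corner_ext_in 1); nc ee'.
case: (primeS (a := d) (b := f')) => // [b|f'0].
  have [x xE] := al_surj b.
  transitivity (d * al x); first by rewrite xE -{1}de; nc.
  rewrite /d mulrBl corner_ext_al mul1r (_ : al (e * x) = al x); last by apply: al_proj; nc ee.
  by rewrite -(al_in x); nc ee'.
by move: (fr_r0 fr'); rewrite f'0 eqxx.
Qed.

Lemma corner_extM a b : corner_ext (a * e * b) = corner_ext a * corner_ext b.
Proof.
rewrite {3}/corner_ext mulr_sumr; apply: eq_bigr => p _.
by rewrite mulrA corner_ext_al; congr (al _ * _); nc.
Qed.

Lemma corner_ext_al_be a b : corner_ext (a * f * b) = al a * be b.
Proof.
transitivity (al a * be b * corner_ext 1).
  rewrite /corner_ext mulr_sumr; apply: eq_bigr => p _.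
  rewrite mul1r mulrA -al_triple; congr (_ * _); apply: al_proj; nc ee.
by rewrite corner_ext1 -(be_in b); nc ee'.
Qed.

(** By [corner_ext1], [e'] is a sum of products of the two blocks; the factor on the right absorbs
    [b * e'] without leaving its block. *)
Lemma corner_generated (C : S -> Prop) b :
  C 0 -> (forall x y, C x -> C y -> C (x + y)) ->
  (forall x y, C x -> C y -> C (x * y)) ->
  (forall x, C (al x)) -> (forall b, C (f' * b * e')) -> C (e' * b * e').
Proof.
move=> C0 CD CM Cal Cbe; rewrite -{1}corner_ext1 /corner_ext !mulr_suml.
apply: (big_ind C) => // p _; rewrite -!mulrA; apply: CM => //.
by rewrite -(be_in p.2); have := Cbe (be p.2 * (e' * b)); rewrite !mulrA.
Qed.

End CornerExtension.

Section RingExtension.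
Variables (F : fieldType) (A : unitAlgType F) (S : unitRingType).
Hypothesis lmA : unital_locally_matrix A.
Hypothesis primeS : forall a b : S, (forall x, a * x * b = 0) -> a = 0 \/ b = 0.
Variables (e f : A) (e' f' : S) (al be : A -> S).
Hypotheses (fr : frame e f) (fr' : frame e' f').
Hypotheses (al_proj : forall x y, e * x * f = e * y * f -> al x = al y)
           (be_proj : forall x y, f * x * e = f * y * e -> be x = be y).
Hypotheses (alD : {morph al : x y / x + y}) (beD : {morph be : x y / x + y}).
Hypotheses (al_in : forall x, e' * al x * f' = al x)
           (be_in : forall x, f' * be x * e' = be x).
Hypotheses (al_surj : forall b, exists x, al x = e' * b * f')
           (be_surj : forall b, exists x, be x = f' * b * e').
Hypothesis al_triple : forall x y z, al (x * f * y * e * z) = al x * be y * al z.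

Let fs := frame_sym fr.
Let fs' := frame_sym fr'.
Let be_triple := dual_triple primeS fr' be_in al_surj al_triple.

Lemma corner_sum (u v : A) : frame u v ->
  exists s : seq (A * A), \sum_(p <- s) u * p.1 * v * p.2 * u = u.
Proof.
move=> fuv; have [s s1] := simple_unit lmA (fr_r0 fuv); exists s.
rewrite -[RHS](fr_l fuv) -{3}[u]mulr1 -s1 mulr_sumr mulr_suml.
by apply: eq_bigr => p _; rewrite !mulrA.
Qed.

Lemma generated_by_blocks (C : S -> Prop) :
  (forall x y, C x -> C y -> C (x + y)) -> (forall x y, C x -> C y -> C (x * y)) ->
  (forall x, C (al x)) -> (forall x, C (be x)) -> forall b, C b.
Proof.
move=> CD CM Cal Cbe b.
have C0 : C 0.
  have := Cal 0; rewrite (_ : al 0 = 0) //.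
  by apply: (addrI (al 0)); rewrite -alD !addr0.
have [s sE] := corner_sum fr; have [t tE] := corner_sum fs.
have Cel b1 : C (e' * b1 * f') by have [x <-] := al_surj b1.
have Cfe b1 : C (f' * b1 * e') by have [x <-] := be_surj b1.
have -> : b = e' * b * f' + f' * b * e' + (e' * b * e' + f' * b * f').
  transitivity ((e' + f') * b * (e' + f')); last by nc.
  by rewrite (fr_1 fr') mul1r mulr1.
apply: (CD); first exact: (CD).
apply: (CD).
  exact: (corner_generated primeS fr fr' al_proj alD al_in be_in al_surj
    al_triple sE b C0 CD CM Cal Cfe).
exact: (corner_generated primeS fs fs' be_proj beD be_in al_in be_surj
  be_triple tE b C0 CD CM Cbe Cel).
Qed.

(** [theta] is the sum of its four Peirce components; it is injective because [A] is simple and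
    surjective because the two blocks generate [S]. *)
Lemma ring_extension : exists theta : {rmorphism A -> S},
  [/\ bijective theta, forall x, theta (e * x * f) = al x
    & forall x, theta (f * x * e) = be x].
Proof.
have [ee ff ef fe ef1 _ _] := fr; have [ee' ff' ef' fe' ef1' _ _] := fr'.
have [s sE] := corner_sum fr; have [t tE] := corner_sum fs.
pose tE_ := corner_ext e al be s; pose tF_ := corner_ext f be al t.
pose theta0 a := al a + be a + (tE_ a + tF_ a).
have tED : {morph tE_ : a b / a + b} by move=> a b; rewrite /tE_ corner_extD.
have tFD : {morph tF_ : a b / a + b} by move=> a b; rewrite /tF_ corner_extD.
have thetaD : {morph theta0 : a b / a + b}.
  by move=> a b; rewrite /theta0 alD beD tED tFD; nc.
have al0 : al 0 = 0 by apply: (addrI (al 0)); rewrite -alD !addr0.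
have be0 : be 0 = 0 by apply: (addrI (be 0)); rewrite -beD !addr0.
have split_mid (a b : A) : a * b = a * e * b + a * f * b.
  by rewrite -mulrDl -mulrDr ef1 mulr1.
have al_eq0 x : e * x * f = 0 -> al x = 0.
  by move=> x0; rewrite -al0; apply: al_proj; rewrite x0 mulr0 mul0r.
have be_eq0 x : f * x * e = 0 -> be x = 0.
  by move=> x0; rewrite -be0; apply: be_proj; rewrite x0 mulr0 mul0r.
have tE_in a : e' * tE_ a * e' = tE_ a := corner_ext_in e fr' al_in be_in s a.
have tF_in a : f' * tF_ a * f' = tF_ a := corner_ext_in f fs' be_in al_in t a.
have tE1 : tE_ 1 = e' :=
  corner_ext1 primeS fr fr' al_proj alD al_in be_in al_surj al_triple sE.
have tF1 : tF_ 1 = f' :=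
  corner_ext1 primeS fs fs' be_proj beD be_in al_in be_surj be_triple tE.
(* Splitting [a b = a e b + a f b] turns each component into a row-by-column product of blocks. *)
have thetaM : {morph theta0 : a b / a * b}.
  move=> a b; rewrite /theta0 (split_mid a b) alD beD tED tFD.
  rewrite /tE_ /tF_ (corner_extM alD al_triple sE) (corner_extM beD be_triple tE).
  rewrite (corner_ext_al_be primeS fr fr' al_proj alD al_in be_in al_surj al_triple sE).
  rewrite (corner_ext_al_be primeS fs fs' be_proj beD be_in al_in be_surj be_triple tE).
  rewrite -(corner_ext_al alD al_triple sE) -(be_corner_ext fs al_proj alD al_triple tE).
  rewrite -(corner_ext_al beD be_triple tE) -(be_corner_ext fr be_proj beD be_triple sE).
  rewrite -/tE_ -/tF_.
  rewrite -(al_in a) -(al_in b) -(be_in a) -(be_in b).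
  rewrite -(tE_in a) -(tE_in b) -(tF_in a) -(tF_in b).
  move: (al a) (al b) (be a) (be b) (tE_ a) (tE_ b) (tF_ a) (tF_ b) => x1 x2 x3 x4 x5 x6 x7 x8.
  by nc (ee', ff', ef', fe').
have theta1 : theta0 1 = 1.
  rewrite /theta0 tE1 tF1 al_eq0 ?be_eq0 ?mulr1 // !add0r.
  exact: fr_1 fr'.
have thetaB : zmod_morphism theta0.
  have theta00 : theta0 0 = 0 by apply: (addrI (theta0 0)); rewrite -thetaD !addr0.
  by move=> a b; apply: (addIr (theta0 b)); rewrite -thetaD !subrK.
pose theta : {rmorphism A -> S} := HB.pack theta0
  (GRing.isZmodMorphism.Build A S theta0 thetaB)
  (GRing.isMonoidMorphism.Build A S theta0 (theta1, thetaM)).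
have theta_al x : theta (e * x * f) = al x.
  rewrite -[LHS]/(theta0 _) /theta0 (al_proj (y := x)); last by nc (ee, ff).
  rewrite be_eq0; last by nc fe.
  rewrite /tE_ /tF_ /corner_ext !big1 ?addr0 // => p _.
    by rewrite be_eq0 ?mul0r //; nc fe.
  by rewrite al_eq0 ?mul0r //; nc fe.
have theta_be x : theta (f * x * e) = be x.
  rewrite -[LHS]/(theta0 _) /theta0 (be_proj (y := x)); last by nc (ee, ff).
  rewrite al_eq0; last by nc ef.
  rewrite /tE_ /tF_ /corner_ext !big1 ?addr0 ?add0r // => p _.
    by rewrite be_eq0 ?mul0r //; nc ef.
  by rewrite al_eq0 ?mul0r //; nc ef.
exists theta; split=> //.
have theta_inj : injective theta.
  apply: raddf_inj => a ta0; apply/eqP; apply: contraT => a0.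
  have [r r1] := simple_unit lmA a0.
  have := oner_neq0 S; rewrite -(rmorph1 theta) -r1 rmorph_sum big1 ?eqxx // => p _.
  by rewrite !rmorphM ta0 mulr0 mul0r.
have theta_surj : forall b, exists a, theta a = b.
  apply: generated_by_blocks => [x y [a <-] [b <-]|x y [a <-] [b <-]|x|x].
  - by exists (a + b); rewrite rmorphD.
  - by exists (a * b); rewrite rmorphM.
  - by exists (e * x * f).
  - by exists (f * x * e).
have [g gK] := choice theta_surj.
by exists g => [a|b] //; apply: theta_inj; rewrite gK.
Qed.

End RingExtension.

(** * Comparison of the group and ring isomorphisms *)

Section CentralFactor.
Variables (F : fieldType) (A : unitAlgType F) (S : unitRingType).
Hypothesis lmA : unital_locally_matrix A.
Hypothesis primeS : forall a b : S, (forall x, a * x * b = 0) -> a = 0 \/ b = 0.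
Variables (P : A -> S) (e f : A) (e' f' : S) (al be : A -> S).
Hypothesis (PM : {in GRing.unit &, {morph P : a b / a * b}}).
Hypotheses (fr : frame e f) (fr' : frame e' f').
Hypotheses (alP : forall x, P (1 + e * x * f) = 1 + al x)
           (beP : forall x, P (1 + f * x * e) = 1 + be x).
Hypotheses (al_in : forall x, e' * al x * f' = al x)
           (be_in : forall x, f' * be x * e' = be x).
Hypotheses (al_surj : forall b, exists x, al x = e' * b * f')
           (be_surj : forall b, exists x, be x = f' * b * e').
Hypothesis al_triple : forall x y z, al (x * f * y * e * z) = al x * be y * al z.

Let fs := frame_sym fr.
Let fs' := frame_sym fr'.

(** Having a central ratio is stable under products of units, so by [unit_LDUL] it suffices to treat
    the root subgroups, with ratio 1, and the centraliser of [e]. A general prime ring [S] is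
    allowed so as to cover the opposite ring of [B]. *)
Lemma central_factor : exists theta : {rmorphism A -> S}, bijective theta /\
  forall g, g \is a GRing.unit ->
    exists2 z, (forall b, z * b = b * z) & P g = z * theta g.
Proof.
have [ee ff ef fe ef1 _ _] := fr; have [ee' ff' ef' fe' ef1' _ _] := fr'.
have al_proj x y : e * x * f = e * y * f -> al x = al y.
  by move=> xy; apply: (addrI 1); rewrite -!alP xy.
have be_proj x y : f * x * e = f * y * e -> be x = be y.
  by move=> xy; apply: (addrI 1); rewrite -!beP xy.
have alD : {morph al : x y / x + y}.
  move=> x y; apply: (addrI 1); rewrite -alP.
  have -> : 1 + e * (x + y) * f = (1 + e * x * f) * (1 + e * y * f) by nc fe.
  rewrite PM ?(block_unit _ fr) // !alP -(al_in x) -(al_in y).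
  by move: (al x) (al y) => u v; nc fe'.
have beD : {morph be : x y / x + y}.
  move=> x y; apply: (addrI 1); rewrite -beP.
  have -> : 1 + f * (x + y) * e = (1 + f * x * e) * (1 + f * y * e) by nc ef.
  rewrite PM ?(block_unit _ fs) // !beP -(be_in x) -(be_in y).
  by move: (be x) (be y) => u v; nc ef'.
have [theta [theta_bij theta_al theta_be]] := ring_extension lmA primeS fr fr'
  al_proj be_proj alD beD al_in be_in al_surj be_surj al_triple.
exists theta; split=> //.
pose good g := exists2 z, (forall b, z * b = b * z) & P g = z * theta g.
have goodM g h : g \is a GRing.unit -> h \is a GRing.unit -> good g -> good h -> good (g * h).
  move=> gu hu [z zC Pg] [t tC Ph]; exists (z * t); first by move=> b; nc (zC b, tC b).
  by rewrite PM // Pg Ph rmorphM; nc (esym (tC (theta g))).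
have good_al x : good (1 + e * x * f).
  by exists 1 => [b|]; rewrite ?mul1r ?mulr1 // alP rmorphD rmorph1 theta_al.
have good_be x : good (1 + f * x * e).
  by exists 1 => [b|]; rewrite ?mul1r ?mulr1 // beP rmorphD rmorph1 theta_be.
(* Conjugation by [P h] and by [theta h] agree on both blocks, so the ratio centralises the blocks,
   which generate [S]. *)
have good_diag h : h \is a GRing.unit -> h * e = e * h -> good h.
  move=> hu he; have hf : h * f = f * h.
    by rewrite (frame_rE fr) mulrBl mulrBr he mul1r mulr1.
  have tu : theta h \is a GRing.unit by exact: rmorph_unit.
  pose z := (theta h)^-1 * P h.
  have Phz : P h = theta h * z by rewrite /z mulVKr.
  suff zC b : z * b = b * z by exists z; rewrite // zC.
  have comm (u v : S) : P h * u = v * P h -> theta h * u = v * theta h -> z * u = u * z.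
    move=> h1 h2; apply: (mulrI tu); rewrite mulrA -Phz h1 mulrA h2.
    by rewrite -mulrA -Phz.
  have hVf : h^-1 * f = f * h^-1 by apply: (mulrI hu); rewrite mulVKr // mulrA hf mulrK.
  have hVe : h^-1 * e = e * h^-1 by apply: (mulrI hu); rewrite mulVKr // mulrA he mulrK.
  have al_comm x : z * al x = al x * z.
    have conj : h * (e * x * f) = e * (h * x * h^-1) * f * h.
      rewrite mulrA mulrA he -!mulrA; congr (_ * (_ * (_ * _))).
      by rewrite (mulrA _ f) hVf -mulrA mulVr // mulr1.
    apply: (comm _ (al (h * x * h^-1))).
      apply: (addrI (P h)); transitivity (P h * P (1 + e * x * f)); first by rewrite alP; nc.
      transitivity (P (1 + e * (h * x * h^-1) * f) * P h); last by rewrite alP; nc.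
      rewrite -!PM ?(block_unit _ fr) //; congr P; rewrite mulrDr mulrDl conj.
      by nc.
    by rewrite -theta_al -rmorphM conj rmorphM theta_al.
  have be_comm x : z * be x = be x * z.
    have conj : h * (f * x * e) = f * (h * x * h^-1) * e * h.
      rewrite mulrA mulrA hf -!mulrA; congr (_ * (_ * (_ * _))).
      by rewrite (mulrA _ e) hVe -mulrA mulVr // mulr1.
    apply: (comm _ (be (h * x * h^-1))).
      apply: (addrI (P h)); transitivity (P h * P (1 + f * x * e)); first by rewrite beP; nc.
      transitivity (P (1 + f * (h * x * h^-1) * e) * P h); last by rewrite beP; nc.
      rewrite -!PM ?(block_unit _ fs) //; congr P; rewrite mulrDr mulrDl conj.
      by nc.
    by rewrite -theta_be -rmorphM conj rmorphM theta_be.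
  move: b; apply: (generated_by_blocks lmA primeS fr fr' al_proj be_proj alD beD
    al_in be_in al_surj be_surj al_triple) => // x y xC yC.
    by rewrite mulrDr mulrDl xC yC.
  by nc (xC, yC).
move=> g /(unit_LDUL lmA fr)[c [b [y [D [Du De ->]]]]].
have uL u : 1 + f * u * e \is a GRing.unit := block_unit u fs.
have uU u : 1 + e * u * f \is a GRing.unit := block_unit u fr.
apply: (goodM); rewrite ?rpredM //; apply: (goodM); rewrite ?rpredM //.
by apply: (goodM) => //; exact: good_diag.
Qed.

End CentralFactor.

(** * The isomorphism theorem *)

Section Abelianize.
Variables (G H : groupType) (c : G -> H).
Local Open Scope group_scope.
Hypotheses (HC : forall u v : H, u * v = v * u) (cM : {morph c : x y / x * y}).

Lemma abel_factor : exists chi : {multiplicative abelianization G -> H},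
  forall g, chi (abel g) = c g.
Proof.
have c1 : c 1 = 1 by apply: (mulgI (c 1)); rewrite -cM !mulg1.
have cV x : c x^-1 = (c x)^-1 by apply: (mulgI (c x)); rewrite -cM !mulgV c1.
have c_derived x : derived x -> c x = 1.
  elim=> [u v||u v _ IHu _ IHv|u _ IHu] //.
  - by rewrite /commg /conjg !cM !cV (HC (c u) (c v)) mulKg mulVg.
  - by rewrite cM IHu IHv mulg1.
  - by rewrite cV IHu invg1.
have c_abel x y : abel x = abel y -> c x = c y.
  by move/abelP/c_derived; rewrite cM cV => h; apply: (mulgI (c x)^-1); rewrite h mulVg.
pose chi u := c (abel_repr u).
have chiM : {morph chi : u v / u * v}.
  move=> u v; rewrite /chi -cM; apply: c_abel.
  by rewrite abel_reprK abel_is_mul !abel_reprK.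
pose chi' : {multiplicative abelianization G -> H} :=
  HB.pack chi (isMultiplicative.Build _ _ chi chiM).
exists chi' => g.
by apply: c_abel; rewrite abel_reprK.
Qed.

End Abelianize.

(** * Central homotheties from scalar ratios *)

Section UnitsMorphism.
Variables (F : fieldType) (A B : unitAlgType F).
Variables (phi : {multiplicative units A -> units B}) (E : units A -> B).
Hypothesis EM : forall g h, E (g * h)%g = E g * E h.
Hypothesis phiE : forall g, exists c : F, val (phi g) = c *: E g.

(** As [E g] is nonzero, the scalar ratio is determined by [g], hence multiplicative, and it factors
    through the abelianization since [F] is commutative. *)
Lemma scalar_ratio_homothety : exists chi : central_homothety A,
  forall g, val (phi g) = val (chi (abel g)) *: E g.
Proof.
have phi_neq0 g : val (phi g) != 0.
  by apply: contraTneq (unitsP (phi g)) => ->; rewrite unitr0.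
have phiU g : exists c : units F, val (phi g) = val c *: E g.
  have [c gE] := phiE g; have cu : c \is a GRing.unit.
    by rewrite unitfE; apply: contraNneq (phi_neq0 g) => c0; rewrite gE c0 scale0r.
  by exists (Units cu).
have [c cE] := choice phiU.
have E_neq0 g : E g != 0.
  by apply: contraNneq (phi_neq0 g) => E0; rewrite cE E0 scaler0.
have cM : {morph c : g h / (g * h)%g}.
  move=> g h; apply: val_inj; rewrite val_unitsM; apply/eqP; rewrite -subr_eq0.
  have : (val (c (g * h)%g) - val (c g) * val (c h)) *: E (g * h)%g == 0.
    by rewrite scalerBl -cE gmulfM val_unitsM !cE EM -scalerAl -scalerAr scalerA subrr.
  by rewrite scaler_eq0 (negPf (E_neq0 _)) orbF.
have FC (u v : units F) : (u * v = v * u)%g by apply: val_inj; rewrite !val_unitsM mulrC.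
have [chi chiE] := abel_factor FC cM.
by exists chi => g; rewrite chiE.
Qed.

Definition units_ext (a : A) : B :=
  if insub a is Some g then val (phi g) else 0.

Lemma units_extE g : units_ext (val g) = val (phi g).
Proof. by rewrite /units_ext valK. Qed.

Lemma units_ext_unit a : a \is a GRing.unit ->
  exists2 g : units A, a = val g & units_ext a = val (phi g).
Proof. by move=> au; exists (Units au) => //; rewrite -units_extE. Qed.

End UnitsMorphism.

Lemma units_ext_group_iso (F : fieldType) (A B : unitAlgType F)
    (phi : {multiplicative units A -> units B}) : bijective phi ->
  exists Q, group_iso (units_ext phi) Q.
Proof.
case=> psi phiK psiK.
have psiM : {morph psi : x y / (x * y)%g}.
  by move=> x y; rewrite -{1}[x]psiK -{1}[y]psiK -gmulfM phiK.
pose psi' : {multiplicative units B -> units A} :=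
  HB.pack psi (isMultiplicative.Build _ _ psi psiM).
exists (units_ext psi'); split.
- by move=> a /(units_ext_unit phi)[g _ ->]; exact: unitsP.
- by move=> a /(units_ext_unit psi')[g _ ->]; exact: unitsP.
- move=> a b au bu; rewrite -[a]/(val (Units au)) -[b]/(val (Units bu)) -val_unitsM.
  by rewrite !units_extE gmulfM.
- move=> a b au bu; rewrite -[a]/(val (Units au)) -[b]/(val (Units bu)) -val_unitsM.
  by rewrite !units_extE gmulfM.
- by move=> a /(units_ext_unit phi)[g -> ->]; rewrite units_extE; congr val; exact: phiK.
- by move=> a /(units_ext_unit psi')[g -> ->]; rewrite units_extE; congr val; exact: psiK.
Qed.

Section Isomorphisms.
Variables (F : fieldType).
Hypotheses (char_not2 : 2%N \notin [pchar F]) (char_not3 : 3%N \notin [pchar F]).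
Variables (A B : unitAlgType F).
Hypotheses (lmA : unital_locally_matrix A) (lmB : unital_locally_matrix B).

Section FrameCase.
Variables (P : A -> B) (Q : B -> A).
Hypothesis PQ : group_iso P Q.
Variables (e f : A) (e' f' : B).
Hypotheses (fr : frame e f) (fr' : frame e' f').
Hypotheses (M : matched P e f e' f') (N : matched Q e' f' e f).
Notation al := (block_map P e f).
Notation be := (block_map P f e).

Let fs := frame_sym fr.
Let fs' := frame_sym fr'.
Let MS := matched_sym fr fr' M.
Let NS := matched_sym fr' fr N.

Lemma iso_of_triple :
  (forall x y z, al (x * f * y * e * z) = al x * be y * al z) ->
  exists theta : {rmorphism A -> B}, bijective theta /\
    forall g, g \is a GRing.unit -> exists c : F, P g = c *: theta g.
Proof.
move=> triple; have [theta [theta_bij thetaP]] := central_factor lmA (prime_alg lmB)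
  (gi_mul PQ) fr fr' (block_mapE P e f) (block_mapE P f e)
  (block_map_in fr' M) (block_map_in fs' MS) (block_map_surj PQ fr' N)
  (block_map_surj PQ fs' NS) triple.
exists theta; split=> // g /thetaP[z zC ->].
have [|c ->] := center_scalar char_not2 lmB (z := z); first by move=> w _.
by exists c; rewrite -scalerAl mul1r.
Qed.

(** [central_factor] is applied to [P' g = (P g)^-1] with values in the opposite ring. Inversion
    changes the sign of both block maps, and three signs leave one in the triple product. *)
Lemma anti_iso_of_triple :
  (forall x y z, al (x * f * y * e * z) = al z * be y * al x) ->
  exists theta : {additive A -> B}, anti_isomorphism theta /\
    forall g, g \is a GRing.unit -> exists c : F, P g = c *: theta g^-1.
Proof.
move=> triple.
pose P' (a : A) : B^c := (P a)^-1.
pose al' (x : A) : B^c := - al x; pose be' (x : A) : B^c := - be x.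
have primeBc (a b : B^c) : (forall x, a * x * b = 0) -> a = 0 \/ b = 0.
  move=> ab; apply/or_comm/(prime_alg lmB) => x.
  by rewrite -mulrA; exact: (ab x).
have P'M : {in GRing.unit &, {morph P' : a b / a * b}}.
  move=> a b au bu; rewrite /P' (gi_mul PQ) //.
  by apply: invrM; exact: (gi_unit PQ).
(* The block [e' B f'] becomes [f' B^c e'], so the idempotents are exchanged. *)
have frc : @frame (B^c) f' e'.
  by case: fr' => *; split=> //; rewrite addrC.
have al'P x : P' (1 + e * x * f) = 1 + al' x.
  rewrite /P' block_mapE /al'; have [_ ax _ xa] := block_map_rules fr' M x.
  have xx : al x * al x = 0.
    have [_ _ h _] := block_map_rules fr' M x.
    by rewrite -{1}ax -mulrA h mulr0.
  apply: (mulrI (unit_1D_square0 xx)); rewrite mulrV ?(unit_1D_square0 xx) //.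
  by nc xx.
have be'P x : P' (1 + f * x * e) = 1 + be' x.
  rewrite /P' block_mapE /be'; have [_ ax _ xa] := block_map_rules fs' MS x.
  have xx : be x * be x = 0.
    have [_ _ h _] := block_map_rules fs' MS x.
    by rewrite -{1}ax -mulrA h mulr0.
  apply: (mulrI (unit_1D_square0 xx)); rewrite mulrV ?(unit_1D_square0 xx) //.
  by nc xx.
have al'_in x : (f' : B^c) * al' x * (e' : B^c) = al' x.
  change (e' * (- al x * f') = - al x).
  by rewrite mulNr mulrN mulrA (block_map_in fr' M).
have be'_in x : (e' : B^c) * be' x * (f' : B^c) = be' x.
  change (f' * (- be x * e') = - be x).
  by rewrite mulNr mulrN mulrA (block_map_in fs' MS).
have al'_surj (b : B) : exists x, al' x = (f' : B^c) * b * (e' : B^c).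
  have [x xE] := block_map_surj PQ fr' N (- b); exists x.
  change (- al x = e' * (b * f')); rewrite xE; nc.
have be'_surj (b : B) : exists x, be' x = (e' : B^c) * b * (f' : B^c).
  have [x xE] := block_map_surj PQ fs' NS (- b); exists x.
  change (- be x = f' * (b * e')); rewrite xE; nc.
have triple' x y z : al' (x * f * y * e * z) = al' x * be' y * al' z.
  change (- al (x * f * y * e * z) = (- al z) * ((- be y) * (- al x))).
  by rewrite triple; nc.
have [theta [theta_bij thetaP]] := central_factor lmA primeBc P'M fr frc
  al'P be'P al'_in be'_in al'_surj be'_surj triple'.
pose theta2 : {additive A -> B} := HB.pack (theta : A -> B)
  (GRing.isZmodMorphism.Build A B theta (raddfB theta)).
exists theta2; split.
  by split=> // a b; exact: (rmorphM theta a b).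
move=> g gu; have [z zC Pg] := thetaP g gu.
pose tg : B := theta g; pose zB : B := z.
have {}Pg : (P g)^-1 = tg * zB by exact: Pg.
have [|c zc] := center_scalar char_not2 lmB (z := zB).
  by move=> w _; exact: (esym (zC w)).
(* The scalar is inverted because [c] compares [theta g] with the inverse of [P g]. *)
exists c^-1; rewrite -[LHS]invrK Pg zc -scalerAr mulr1.
have -> : theta2 g^-1 = tg^-1 by exact: (rmorphV theta gu).
have c0 : c != 0.
  apply: contraTneq (gi_unit PQ gu) => c0.
  by rewrite -unitrV Pg zc c0 scale0r mulr0 unitr0.
have tu : tg \is a GRing.unit by exact: (rmorph_unit theta gu).
by rewrite invrZ ?unitfE.
Qed.

End FrameCase.

Lemma scalar_iso :
  (forall a : A, exists c : F, a = c%:A) -> (forall b : B, exists c : F, b = c%:A) ->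
  exists theta : {rmorphism A -> B}, bijective theta.
Proof.
move=> Ascal Bscal; have [l lE] := choice Ascal; have [m mE] := choice Bscal.
have A_inj : injective (fun c : F => c%:A : A) by exact: (fmorph_inj (in_alg A)).
have B_inj : injective (fun c : F => c%:A : B) by exact: (fmorph_inj (in_alg B)).
pose theta a : B := (l a)%:A.
have thetaE c : theta c%:A = c%:A by congr (_%:A); apply: A_inj; rewrite /= -lE.
have thetaB : zmod_morphism theta.
  move=> a b; have [c ->] := Ascal a; have [d ->] := Ascal b.
  by rewrite -scalerBl !thetaE scalerBl.
have thetaM : monoid_morphism theta.
  split=> [|a b]; first by rewrite -[1 in LHS]scale1r thetaE scale1r.
  have [c ->] := Ascal a; have [d ->] := Ascal b.
  by rewrite -scalerAl mul1r scalerA !thetaE -scalerAl mul1r scalerA.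
pose theta' : {rmorphism A -> B} := HB.pack theta
  (GRing.isZmodMorphism.Build A B theta thetaB)
  (GRing.isMonoidMorphism.Build A B theta thetaM).
exists theta'; exists (fun b => (m b)%:A) => [a|b].
  have [c ->] := Ascal a; rewrite -[theta' _]/(theta _) thetaE.
  by congr (_ *: _); apply: B_inj; rewrite /= -mE.
by rewrite -[LHS]/(theta _) thetaE -mE.
Qed.

End Isomorphisms.

Theorem theorem4 (F : fieldType)
    (char_not2 : 2%N \notin [pchar F]) (char_not3 : 3%N \notin [pchar F])
    (A B : unitAlgType F)
    (lmA : unital_locally_matrix A) (lmB : unital_locally_matrix B)
    (phi : {multiplicative units A -> units B}) (phi_bij : bijective phi) :
  exists chi : central_homothety A,
    (exists theta1 : {rmorphism A -> B},
       bijective theta1 /\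
       forall g : units A,
         val (phi g) = val (chi (abel g)) *: theta1 (val g))
    \/
    (exists theta2 : {additive A -> B},
       anti_isomorphism theta2 /\
       forall g : units A,
         val (phi g) = val (chi (abel g)) *: theta2 (val (g^-1)%g)).
Proof.
have [Q PQ] := units_ext_group_iso phi_bij; set P := units_ext phi in PQ.
have hom_case (theta : {rmorphism A -> B}) : bijective theta ->
    (forall g, g \is a GRing.unit -> exists c : F, P g = c *: theta g) ->
    exists chi : central_homothety A, exists theta1 : {rmorphism A -> B},
      bijective theta1 /\
      forall g : units A, val (phi g) = val (chi (abel g)) *: theta1 (val g).
  move=> theta_bij thetaP.
  have [||chi chiE] := @scalar_ratio_homothety _ _ _ phi (fun g => theta (val g)).
  - by move=> g h; rewrite -rmorphM.
  - by move=> g; have [c] := thetaP _ (unitsP g); rewrite /P units_extE; exists c.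
  by exists chi, theta.
have [Ascal|[e [ee e0 e1]]] := scalar_or_idempotent lmA.
  have [Bscal|[e' [e'e' e'0 e'1]]] := scalar_or_idempotent lmB.
    have [theta theta_bij] := scalar_iso Ascal Bscal.
    have [|chi chiP] := hom_case theta theta_bij; last by exists chi; left.
    move=> g gu; have : theta g != 0.
      by apply: contraTneq (rmorph_unit theta gu) => ->; rewrite unitr0.
    have [c ->] := Bscal (P g); have [d ->] := Bscal (theta g) => d0.
    have {}d0 : d != 0 by apply: contraNneq d0 => ->; rewrite scale0r.
    by exists (c / d); rewrite scalerA divfK.
  (* A nontrivial idempotent of [B] would pull back to one of [A], but a scalar idempotent is 0 or
     1. *)
  have [e [ee e0 e1 _]] := image_idempotent char_not2 lmA (group_iso_sym PQ) e'e' e'0 e'1.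
  have [c ec] := Ascal e; move: ee e0 e1; rewrite ec -scalerAl mul1r scalerA => cc c0.
  have : (c * (c - 1)) *: (1 : A) == 0 by rewrite mulrBr mulr1 scalerBl cc subrr.
  rewrite scaler_eq0 oner_eq0 orbF mulf_eq0 subr_eq0 => /orP[] /eqP c01.
    by rewrite c01 scale0r eqxx in c0.
  by rewrite c01 scale1r eqxx.
have fr := frame_compl ee e0 e1.
have [e' [f' [fr' M N]]] := matched_frame char_not2 char_not3 lmA lmB PQ fr.
have [triple|triple] := block_map_triple_dichotomy char_not2 char_not3 lmA lmB PQ fr fr' M N.
  have [theta [theta_bij thetaP]] := iso_of_triple char_not2 lmA lmB PQ fr fr' M N triple.
  by have [chi chiP] := hom_case theta theta_bij thetaP; exists chi; left.
have [theta [theta_anti thetaP]] := anti_iso_of_triple char_not2 lmA lmB PQ fr fr' M N triple.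
(* Inversion and [theta] both reverse products, so their composite is multiplicative. *)
have [||chi chiE] := @scalar_ratio_homothety _ _ _ phi (fun g => theta (val (g^-1)%g)).
- by move=> g h; rewrite invgM val_unitsM theta_anti.2.
- by move=> g; have [c] := thetaP _ (unitsP g); rewrite /P units_extE; exists c.
by exists chi; right; exists theta.
Qed.
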